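(* For all $f\in C_0^\infty(\mathbb{H}^N)$, $$\int_{\mathbb{H}^N}|\nabla_{\mathbb{H}}f|^2dV_{\mathbb{H}}-\int_{\mathbb{H}^N}\left[\frac{(N-1)^2}{4}+\frac14\frac{1}{\rho^2(x)}+\frac{(N-1)(N-3)}{4}\frac{1}{\sinh^2\rho(x)}\right]|f|^2dV_{\mathbb{H}}=\int_{\mathbb{H}^N}\frac{\rho(x)}{\sinh^{N-1}\rho(x)}\left|\nabla_{\mathbb{H}}\left(\frac{\sinh^{\frac{N-1}{2}}\rho(x)\,f}{\rho^{\frac12}(x)}\right)\right|^2dV_{\mathbb{H}},$$ $$\int_{\mathbb{H}^N}|\partial_\rho f|^2dV_{\mathbb{H}}-\int_{\mathbb{H}^N}\left[\frac{(N-1)^2}{4}+\frac14\frac{1}{\rho^2(x)}+\frac{(N-1)(N-3)}{4}\frac{1}{\sinh^2\rho(x)}\right]|f|^2dV_{\mathbb{H}}=\int_{\mathbb{H}^N}\frac{\rho(x)}{\sinh^{N-1}\rho(x)}\left|\partial_\rho\left(\frac{\sinh^{\frac{N-1}{2}}\rho(x)\,f}{\rho^{\frac12}(x)}\right)\right|^2dV_{\mathbb{H}},$$ and $$\int_{\mathbb{H}^N}|\nabla_{\mathbb{H}}f|^2dV_{\mathbb{H}}\ge\int_{\mathbb{H}^N}|\partial_\rho f|^2dV_{\mathbb{H}}\ge\int_{\mathbb{H}^N}\left[\frac{(N-1)^2}{4}+\frac14\frac{1}{\rho^2(x)}+\frac{(N-1)(N-3)}{4}\frac{1}{\sinh^2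\rho(x)}\right]|f|^2dV_{\mathbb{H}}.$$
   Context: $\mathbb{H}^N$ is the $N$-dimensional hyperbolic space of constant sectional curvature $-1$, with gradient $\nabla_{\mathbb{H}}$ and volume element $dV_{\mathbb{H}}$; $\rho(x)$ is the geodesic distance from $x$ to a fixed point $O\in\mathbb{H}^N$ (the origin in the Poincaré ball model). $\partial_\rho f(x)=\frac{d}{dt}\big|_{t=\rho(x)}f(\exp_O(tu))$, where $x=\exp_O(\rho(x)u)$ with $u$ a unit tangent vector at $O$, is the radial derivative. $C_0^\infty(U)$ denotes smooth compactly supported functions on $U$. *)

(* Defs.v *)
From HB Require Import structures.
From mathcomp Require Import all_boot all_order all_algebra.
From mathcomp Require Import all_classical all_reals all_analysis.
Set Implicit Arguments.
Unset Strict Implicit.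
Unset Printing Implicit Defensive.
Import Order.TTheory GRing.Theory Num.Theory.
Import numFieldNormedType.Exports.

Local Open Scope classical_set_scope.
Local Open Scope ring_scope.

(* The n-dimensional Lebesgue measure is the n-fold product of lebesgue_measure,
   built by recursion on n along the bijection R * R^n -> R^n.+1. *)
Section lebesgue_tuple.
Context {R : realType}.

Definition cons_pair n (p : R * n.-tuple R) : n.+1.-tuple R :=
  [tuple of p.1 :: p.2].

Lemma measurable_cons_pair n : measurable_fun [set: R * n.-tuple R] (@cons_pair n).
Proof.
apply: measurable_cons; first exact: measurable_fst.
exact: measurable_snd.
Qed.

Section step.
Variables (n : nat) (m : {sigma_finite_measure set (n.-tuple R) -> \bar R}).

Definition lebesgue_cons : set (n.+1.-tuple R) -> \bar R :=
  pushforward (product_measure1 (@lebesgue_measure R) m) (@cons_pair n).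

Let lebesgue_cons0 : lebesgue_cons set0 = 0%E.
Proof. by rewrite /lebesgue_cons /pushforward preimage_set0 measure0. Qed.

Let lebesgue_cons_ge0 A : (0 <= lebesgue_cons A)%E.
Proof. by rewrite /lebesgue_cons /pushforward measure_ge0. Qed.

Let lebesgue_cons_sigma_additive : semi_sigma_additive lebesgue_cons.
Proof.
rewrite /lebesgue_cons; move=> F mF tF mUF; rewrite /pushforward preimage_bigcup.
have mpre A : measurable A -> measurable (@cons_pair n @^-1` A).
  by move=> mA; rewrite -[X in measurable X]setTI; exact: measurable_cons_pair.
apply: measure_semi_sigma_additive => [i||]; first exact: mpre.
- apply/trivIsetP => /= i j _ _ ij; rewrite -preimage_setI.
  by move/trivIsetP : tF => /(_ _ _ _ _ ij) ->//; rewrite preimage_set0.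
- by rewrite -preimage_bigcup; exact: mpre.
Qed.

HB.instance Definition _ := isMeasure.Build _ _ _
  lebesgue_cons lebesgue_cons0 lebesgue_cons_ge0 lebesgue_cons_sigma_additive.

Let lebesgue_cons_sigma_finite : sigma_finite setT lebesgue_cons.
Proof.
have [F TF mF] : sigma_finite setT (product_measure1 (@lebesgue_measure R) m).
  have /sigma_finiteP[A [TA ndA Aoo]] := sigma_finiteT (@lebesgue_measure R).
  have /sigma_finiteP[B [TB ndB Boo]] := sigma_finiteT m.
  exists (fun k => A k `*` B k).
    rewrite -setXTT TA TB predeqE => -[x y]; split.
      move=> [/= [i _ Aix] [k _ Bky]]; exists (maxn i k) => //; split.
      - by move: x Aix; exact/subsetPset/ndA/leq_maxl.
      - by move: y Bky; exact/subsetPset/ndB/leq_maxr.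
    by move=> [i _ []/= ? ?]; split; exists i.
  move=> k; have [? ?] := Aoo k; have [? ?] := Boo k.
  split; first exact: measurableX.
  by rewrite product_measure1E// lte_mul_pinfty// ge0_fin_numE.
pose uncons (t : n.+1.-tuple R) : R * n.-tuple R :=
  (thead t, [tuple of behead t]).
have unconsK : cancel uncons (@cons_pair n).
  by move=> t; rewrite /cons_pair /=; apply/esym; exact: tuple_eta.
have cons_pairK : cancel (@cons_pair n) uncons.
  move=> [x t]; rewrite /uncons /cons_pair theadE /=; congr (_, _).
  exact: val_inj.
have muncons : measurable_fun setT uncons.
  apply: measurable_fun_pair; first exact: measurable_tnth.
  exact: measurable_behead.
exists (fun i => uncons @^-1` F i).
  by rewrite -preimage_bigcup -TF preimage_setT.
move=> i; have [mFi Fi_lty] := mF i; split.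
  by rewrite -[X in measurable X]setTI; exact: muncons.
rewrite /lebesgue_cons /pushforward -comp_preimage.
by rewrite (_ : uncons \o _ = id) //; apply/funext => p; exact: cons_pairK.
Qed.

HB.instance Definition _ := Measure_isSigmaFinite.Build _ _ _
  lebesgue_cons lebesgue_cons_sigma_finite.

End step.

Fixpoint lebesgue_tuple (n : nat) :
    {sigma_finite_measure set (n.-tuple R) -> \bar R} :=
  match n with
  | 0 => \d_([tuple] : 0.-tuple R)
  | k.+1 => lebesgue_cons (lebesgue_tuple k)
  end.

End lebesgue_tuple.

Section hyperbolic.
Context {R : realType} {N : nat}.
Local Notation E := 'rV[R]_N.
Implicit Types (x y v w : E) (f : E -> R) (c : R -> E).

(* Poincare ball model: the open Euclidean unit ball with metric tensor
   4 (1 - |x|^2)^-2 delta_ij. (The norm `|x| of 'rV[R]_N is the sup norm.) *)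
Definition sqnorm x : R := \sum_i x 0 i ^+ 2.
Definition poincare_ball : set E := [set x | sqnorm x < 1].
Definition hmetric x : 'M[R]_N := (4 / (1 - sqnorm x) ^+ 2)%:M.

Definition hinner x v w : R := (v *m hmetric x *m w^T) 0 0.
Definition hnorm x v : R := Num.sqrt (hinner x v v).

Definition partial (i : 'I_N) f : E -> R := fun x => 'D_(delta_mx 0 i) f x.

Definition hgrad f x : E := (\row_i partial i f x) *m invmx (hmetric x).

Definition hintegral (F : E -> R) : \bar R :=
  (\int[@lebesgue_tuple R N]_(t in [set t | poincare_ball (\row_i tnth t i)])
     (F (\row_i tnth t i) * Num.sqrt (\det (hmetric (\row_i tnth t i))))%:E)%E.

Definition is_C1_path x y c : Prop :=
  [/\ forall t, 0 <= t <= 1 -> poincare_ball (c t) /\ derivable c t 1,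
      {within `[0, 1], continuous (derive1 c)},
      c 0 = x & c 1 = y].

Definition hlength c : R :=
  (\int[@lebesgue_measure R]_(t in `[0, 1]) hnorm (c t) (derive1 c t))%R.

Definition hdist x y : R := inf [set hlength c | c in is_C1_path x y].

(* christoffel k i j is Gamma^k_ij of the Levi-Civita connection. *)
Definition christoffel (k i j : 'I_N) x : R :=
  2^-1 * \sum_l invmx (hmetric x) k l *
    (partial i (fun z => hmetric z j l) x + partial j (fun z => hmetric z i l) x
     - partial l (fun z => hmetric z i j) x).

(* Hyperbolic space is complete, so its geodesics are defined on all of R. *)
Definition is_geodesic c : Prop :=
  forall t, [/\ poincare_ball (c t), derivable c t 1, derivable (derive1 c) t 1
    & forall k, derive1 (derive1 c) t 0 k +
        \sum_i \sum_j christoffel k i j (c t) * derive1 c t 0 i * derive1 c t 0 j = 0].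

Definition hexp x v : E :=
  xget 0 [set y | exists c, [/\ is_geodesic c, c 0 = x, derive1 c 0 = v & c 1 = y]].

Definition rho x : R := hdist 0 x.

(* The unit tangent vector u at the origin with x = exp_O(rho(x) u); it is unique
   for x in the ball minus the origin. *)
Definition radial_dir x : E :=
  xget 0 [set u | hnorm 0 u = 1 /\ hexp 0 (rho x *: u) = x].

Definition radial_derive f x : R :=
  derive1 (fun t : R => f (hexp 0 (t *: radial_dir x))) (rho x).

(* C^oo on the ball: every iterated partial derivative is differentiable there.
   Values of f outside the ball are irrelevant. *)
Definition hsmooth f : Prop :=
  forall (s : seq 'I_N) x, poincare_ball x ->
    differentiable (foldr partial f s) x.

Definition hcompact_support f : Prop :=
  exists K : set E, [/\ compact K, K `<=` poincare_ball
    & forall x, poincare_ball x -> ~ K x -> f x = 0].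

End hyperbolic.

Definition sinh {R : realType} (t : R) : R := (expR t - expR (- t)) / 2.

(* Main.v *)
(** Let h = (N-1)/2 coth rho - 1/(2 rho), the logarithmic derivative of
    phi = sinh^((N-1)/2) rho / rho^(1/2), and let W be the Hardy potential.
    Since W = h' + (N-1) coth rho h - h^2, expanding the square gives
      phi^-2 |grad (phi f)|^2 = |grad f|^2 + div (f^2 h d_rho) - W f^2
    away from the origin, and likewise for radial derivatives. Both identities
    thus amount to the vanishing of the integral of the divergence, and the
    inequalities follow from Cauchy-Schwarz and the nonnegativity of the
    remainder.

    In the ball model the field is x |-> a(x) x for a function a singular at the
    origin. Its divergence D satisfies d/ds (s^N a(s x)) = s^(N-1) D(s x);
    integrating over x and over s in [1, 2], the scaling of Lebesgue measure
    turns the two sides into 0 and ln 2 times the integral of D. This needs no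
    cut-off at the origin, only the integrability of a and D, i.e. of |x|^-2
    when N >= 3.

    The Riemannian objects are computed explicitly: the distance from the origin
    to x is ln ((1 + |x|) / (1 - |x|)), and a geodesic issued from the origin is
    determined by its velocity because its image in the hyperboloid model solves
    X'' = E X. *)

Require Import Defs.
From HB Require Import structures.
From mathcomp Require Import all_boot all_order all_algebra.
From mathcomp Require Import all_classical all_reals all_analysis.
From mathcomp Require Import measurable_realfun ring lra.
Set Implicit Arguments.
Unset Strict Implicit.
Unset Printing Implicit Defensive.
Import Order.TTheory GRing.Theory Num.Theory.
Import numFieldNormedType.Exports.
Local Open Scope classical_set_scope.
Local Open Scope ring_scope.

(** * Lebesgue measure on tuples *)

(** Dilations are the only changes of variables of [R^n] used: they act coordinate by coordinate, so
    their Jacobian follows by induction along the recursive product measure. The topology lives on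
    row vectors and the measure on tuples, hence the transfer of measurability from one to the
    other. The case [N = 2] is the delicate one, since [|x|^-2] is not integrable in the plane. Put
    [e = N - 2]. The singular part of [h] is [(e/2) coth rho]; the rest, [(coth rho - 1/rho)/2], is
    at most [|x|]. In the same way the singular part of [W] has the coefficient [e^2/4]. So every
    density is bounded on the support by a constant times [1 + (N-2)/|x|^2], which is plain
    boundedness in the plane and an integrable bound in higher dimension. The identities are between
    extended reals, so each density has to be integrable before integrals are split. At the origin
    the integrands take conventional values, such as inverses of zero; that point is null and is
    removed at the outset. *)

(** Measurable sets are closed under unions indexed by [nat], so a union over a countable type is
    re-indexed through its encoding. *)
Lemma bigcup_pickle (I : countType) (T : Type) (P : set I) (F : I -> set T) :
  \bigcup_(p in P) F p =
  \bigcup_k (if @unpickle I k is Some p then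
               if p \in P then F p else set0 else set0).
Proof.
apply/seteqP; split => [x [p Pp Fpx]|x [k _]].
  by exists (pickle p) => //; rewrite pickleK mem_set.
by case: unpickle => [p|] //; case: ifPn => // /set_mem Pp Fpx; exists p.
Qed.

Section row_of_tuple.
Context {R : realType}.

Definition row_of n (t : n.-tuple R) : 'rV[R]_n := \row_i tnth t i.

Lemma open_bigcup_rat_ball n (U : set 'rV[R]_n) : open U ->
  U = \bigcup_(p in [set p : 'rV[rat]_n * nat |
        ball (map_mx (@ratr R) p.1) p.2.+1%:R^-1 `<=` U])
      ball (map_mx (@ratr R) p.1) p.2.+1%:R^-1.
Proof.
move=> oU; apply/seteqP; split => [x Ux|x [p /= pU xp]]; last exact: pU.
have /nbhs_ballP[e /= e0 xU] : nbhs x U by exact: open_nbhs_nbhs.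
have [m me] : exists m : nat, m.+1%:R^-1 < e / 2.
  have e20 : 0 < e / 2 by rewrite divr_gt0.
  near \oo => m; exists m; near: m; exact: near_infty_natSinv_lt (PosNum e20).
have m0 : 0 < m.+1%:R^-1 :> R by rewrite invr_gt0 ltr0n.
have q i : {q : rat | ratr q \in `](x 0 i - m.+1%:R^-1), (x 0 i + m.+1%:R^-1)[}.
  apply/cid; apply: rat_in_itvoo.
  by rewrite ltrBlDr -addrA ltrDl addr_gt0.
have xq j : ball (x 0 j) m.+1%:R^-1 (ratr (sval (q j)) : R).
  case: (q j) => /= z; rewrite in_itv/= -ltr_distlC => zx.
  by rewrite /ball /=.
exists (\row_i sval (q i), m) => /=.
  move=> y [_ qy]; apply: xU; split => // i j; rewrite (ord1 i).
  have := qy 0 j; rewrite !mxE => qyj; rewrite (splitr e).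
  by apply: (ball_triangle (le_ball (ltW me) (xq j)));
    exact: le_ball (ltW me) _ qyj.
by split => // i j; rewrite !mxE (ord1 i); exact/ball_sym.
Unshelve. all: by end_near. Qed.

(** A ball of the sup norm is a box, so its preimage is a finite intersection of conditions on
    single coordinates; countably many balls with rational centres cover [U]. *)
Lemma measurable_row_of_open n (U : set 'rV[R]_n) :
  open U -> measurable (@row_of n @^-1` U).
Proof.
move=> oU; rewrite (open_bigcup_rat_ball oU) preimage_bigcup.
rewrite bigcup_pickle; apply: bigcupT_measurable => k.
case: unpickle => [[q m]|] //=; case: ifP => // _.
rewrite (_ : _ @^-1` _ = \bigcap_(i in [set: 'I_n])
    ((fun t : n.-tuple R => tnth t i) @^-1` ball (ratr (q 0 i) : R)
      m.+1%:R^-1)).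
  apply: fin_bigcap_measurable => [|i _]; first exact: finite_finset.
  rewrite -[X in measurable X]setTI; apply: measurable_tnth => //.
  by apply: open_measurable; apply: ball_open; rewrite invr_gt0.
apply/seteqP; split => t /=.
  by move=> [_ qt] i _ /=; have := qt 0 i; rewrite !mxE.
move=> qt; split; first by rewrite invr_gt0 ltr0n.
by move=> i j; rewrite ord1 !mxE; exact: qt.
Qed.

Lemma measurable_fun_row_of n (U : set 'rV[R]_n) (F : 'rV[R]_n -> R) :
  open U -> {in U, continuous F} ->
  measurable_fun (@row_of n @^-1` U) (F \o @row_of n).
Proof.
move=> oU cF; apply: (measurability _ (RGenOpens.measurableE R)) =>
  _ [_ [a [b ->] <-]].
rewrite (_ : _ `&` _ = @row_of n @^-1` (U `&` F @^-1` `]a, b[))//;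
  apply: measurable_row_of_open.
rewrite openE => x [Ux Fx]; apply: filterI; first exact: open_nbhs_nbhs.
by apply: cF; [rewrite inE|apply: open_nbhs_nbhs; split => //;
  exact: interval_open].
Qed.

End row_of_tuple.

(** * Dilations of Lebesgue measure *)

Section scaling.
Context {R : realType}.
Local Open Scope ereal_scope.

Lemma ge0_integral_lebesgue_scale (s : R) (F : R -> \bar R) : (0 < s)%R ->
  measurable_fun setT F -> (forall x, 0 <= F x) ->
  \int[lebesgue_measure]_x F (s * x)%R =
  s^-1%:E * \int[lebesgue_measure]_x F x.
Proof.
move=> s0 mF F0.
have ms : measurable_fun setT (fun x : R => s * x : measurableTypeR R)%R.
  exact: measurable_funM.
have -> : \int[lebesgue_measure]_x F (s * x)%R =
    \int[pushforward lebesgue_measure (fun x : R =>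
      s * x : measurableTypeR R)%R]_x F x.
  by rewrite ge0_integral_pushforward.
have si0 : (0 <= s^-1)%R by rewrite invr_ge0 ltW.
rewrite -[(s^-1)%R]/((NngNum si0)%:num) -ge0_integral_mscale//.
apply: eq_measure_integral => A mA _.
(* By uniqueness of the measure that agrees with length on half-open intervals, [s] times the image
   of Lebesgue measure under the dilation is Lebesgue measure. *)
pose mu : {measure set (measurableTypeR R) -> \bar R} :=
  mscale (NngNum (ltW s0)) (pushforward lebesgue_measure (fun x : R =>
    s * x : measurableTypeR R)%R).
have: lebesgue_measure A = mu ms A.
  apply: lebesgue_measure_unique => //= _ [[a b]] _ <-.
  rewrite /mu /mscale /= /pushforward /= !lebesgue_measure_itv /=.
  rewrite (_ : _ @^-1` _ = `](a / s)%R, (b / s)%R]%classic); last first.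
    apply/seteqP; split => x /=; rewrite !in_itv /= ltr_pdivrMr// ler_pdivlMr//;
    by rewrite ![(x * s)%R]mulrC.
  rewrite lebesgue_measure_itv /= !lte_fin ltr_pM2r ?invr_gt0//.
  case: ifPn => _; last by rewrite mule0.
  by rewrite -!EFinD -EFinM -mulrBl mulrCA divff ?mulr1 ?gt_eqF.
move=> H; transitivity (s^-1%:E * lebesgue_measure A); last by [].
have -> : lebesgue_measure A = s%:E * pushforward lebesgue_measure ( *%R s) A.
  exact: H.
by rewrite muleA -EFinM mulVf ?mul1e// gt_eqF.
Qed.

Definition scale_tuple n (s : R) (t : n.-tuple R) : n.-tuple R :=
  [tuple of map ( *%R s) t].

Lemma tnth_scale_tuple n s (t : n.-tuple R) i :
  tnth (scale_tuple s t) i = (s * tnth t i)%R.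
Proof. by rewrite tnth_map. Qed.

Lemma row_of_scale n s (t : n.-tuple R) : row_of (scale_tuple s t) = s *:
  row_of t.
Proof. by apply/rowP => i; rewrite !mxE tnth_scale_tuple. Qed.

Lemma measurable_scale_tuple n :
  measurable_fun setT (fun p : n.-tuple R * R => scale_tuple p.2 p.1).
Proof.
apply/measurable_fun_tnthP => i.
rewrite (_ : _ \o _ = fun p : n.-tuple R * R => p.2 * tnth p.1 i)%R; last first.
  by apply/funext => p /=; rewrite tnth_scale_tuple.
apply: measurable_funM => //.
exact: (measurableT_comp (measurable_tnth i)).
Qed.

Lemma measurable_scale_tupler n s :
  measurable_fun setT (@scale_tuple n s).
Proof.
apply/measurable_fun_tnthP => i.
rewrite (_ : _ \o _ = fun p : n.-tuple R => s * tnth p i)%R; last first.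
  by apply/funext => p /=; rewrite tnth_scale_tuple.
by apply: measurable_funM => //; exact: measurable_tnth.
Qed.

Lemma ge0_integral_tuple_cons n (F : n.+1.-tuple R -> \bar R) :
  measurable_fun setT F -> (forall t, 0 <= F t) ->
  \int[@lebesgue_tuple R n.+1]_t F t =
  \int[lebesgue_measure]_x \int[@lebesgue_tuple R n]_t F [tuple of x :: t].
Proof.
move=> mF F0; rewrite /= /lebesgue_cons ge0_integral_pushforward//.
  rewrite preimage_setT.
  have := @fubini_tonelli1 _ _ _ _ R (@lebesgue_measure R) (@lebesgue_tuple R n)
   (F \o @cons_pair R n); rewrite /product_measure1 => -> //.
  exact: (measurableT_comp mF (@measurable_cons_pair _ _)).
- by move=> x; exact: F0.
- exact: measurable_cons_pair.
Qed.

(** By Tonelli the first coordinate splits off and contributes one factor [s^-1]. *)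
Lemma ge0_integral_scale n (s : R) (F : n.-tuple R -> \bar R) : (0 < s)%R ->
  measurable_fun setT F -> (forall t, 0 <= F t) ->
  \int[@lebesgue_tuple R n]_t F (scale_tuple s t) =
  (s ^- n)%:E * \int[@lebesgue_tuple R n]_t F t.
Proof.
move=> s0; elim: n F => [F mF F0|n IH F mF F0].
  rewrite expr0 invr1 mul1e; apply: eq_integral => t _; congr F.
  by rewrite [scale_tuple _ _]tuple0 [RHS]tuple0.
rewrite !ge0_integral_tuple_cons//; last first.
  exact: (measurableT_comp mF (@measurable_scale_tupler _ _)).
have mc : measurable_fun setT (F \o @cons_pair R n).
  exact: (measurableT_comp mF (@measurable_cons_pair _ _)).
transitivity (\int[lebesgue_measure]_x
    ((s ^- n)%:E * \int[lebesgue_tuple n]_t F [tuple of (s * x)%R :: t])).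
  apply: eq_integral => x _.
  rewrite -(IH (fun t => F [tuple of (s * x)%R :: t]))//.
    by apply: eq_integral => t _; congr F; apply/val_inj.
  exact: (measurableT_comp mc (pair1_measurable _)).
have mG : measurable_fun setT
    (fun x => \int[lebesgue_tuple n]_t F [tuple of x :: t]).
  apply: (@measurable_fun_fubini_tonelli_F _ _ _ _ R (@lebesgue_tuple R n)
    (F \o @cons_pair R n)) => // t; exact: F0.
have G0 x : 0 <= \int[lebesgue_tuple n]_t F [tuple of x :: t].
  exact: integral_ge0.
rewrite ge0_integralZl//; last 2 first.
  - exact: (measurableT_comp mG (measurable_funM _ _)).
  - by rewrite lee_fin invr_ge0 exprn_ge0// ltW.
rewrite (ge0_integral_lebesgue_scale s0 mG)//.
by rewrite muleA -EFinM -invfM -exprSr.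
Qed.

End scaling.

Section tuple_measure.
Context {R : realType}.
Local Open Scope ereal_scope.

Lemma measurable_all_tnth n (A : set R) : measurable A ->
  measurable [set t : n.-tuple R | forall i, A (tnth t i)].
Proof.
move=> mA; rewrite (_ : [set _ | _] =
    \bigcap_(i in [set: 'I_n]) ((fun t : n.-tuple R => tnth t i) @^-1` A)).
  apply: fin_bigcap_measurable => [|i _]; first exact: finite_finset.
  by rewrite -[X in measurable X]setTI; exact: measurable_tnth.
by apply/seteqP; split => t /= At i; [move=> _|]; exact: At.
Qed.

Lemma lebesgue_tuple_all n (A : set R) : measurable A ->
  @lebesgue_tuple R n [set t | forall i,
    A (tnth t i)] = lebesgue_measure A ^+ n.
Proof.
move=> mA; elim: n => [|n IH].
  by rewrite expe0 /= diracE mem_set// => -[].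
rewrite expeS -IH -product_measure1E//; last exact: measurable_all_tnth.
rewrite /= /lebesgue_cons /pushforward; congr (product_measure1 _ _ _).
apply/seteqP; split => [[x t] /= At|[x t] [/= Ax At]].
  split => /= [|i]; first exact: (At ord0).
  by have := At (lift ord0 i); rewrite tnthS.
by move=> i; case: (unliftP ord0 i) => [j ->|->]; rewrite ?tnthS// tnth0.
Qed.

Lemma lebesgue_tuple0 n : @lebesgue_tuple R n.+1 [set t | row_of t = 0%R] = 0.
Proof.
rewrite (_ : [set _ | _] = [set t : n.+1.-tuple R | forall i,
  [set 0%R] (tnth t i)]).
  by rewrite lebesgue_tuple_all// lebesgue_measure_set1 expeS mul0e.
apply/seteqP; split => t /=.
  by move=> /rowP t0 i; have := t0 i; rewrite !mxE.
by move=> t0; apply/rowP => i; rewrite !mxE.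
Qed.

Lemma integrable_scale n (s : R) (F : n.-tuple R -> \bar R) : (0 < s)%R ->
  (@lebesgue_tuple R n).-integrable setT F ->
  (@lebesgue_tuple R n).-integrable setT (F \o scale_tuple s).
Proof.
move=> s0 /integrableP[mF iF]; apply/integrableP; split.
  exact: (measurableT_comp mF (@measurable_scale_tupler _ _ _)).
rewrite (@ge0_integral_scale _ n s (abse \o F))//.
  by rewrite lte_mul_pinfty// ?lee_fin ?invr_ge0 ?exprn_ge0// ltW.
- exact: measurableT_comp.
- by move=> t /=; exact: abse_ge0.
Qed.

Lemma integral_scale n (s : R) (F : n.-tuple R -> \bar R) : (0 < s)%R ->
  (@lebesgue_tuple R n).-integrable setT F ->
  \int[@lebesgue_tuple R n]_t F (scale_tuple s t) =
  (s ^- n)%:E * \int[@lebesgue_tuple R n]_t F t.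
Proof.
move=> s0 iF; have mF := measurable_int _ iF.
rewrite -[LHS]/(\int[_]_t (F \o scale_tuple s) t).
rewrite integralE funepos_comp funeneg_comp !ge0_integral_scale//; last 2 first.
  exact: measurable_funeneg.
  exact: measurable_funepos.
rewrite [in RHS]integralE [in RHS]muleBr//.
apply: fin_num_adde_defr; exact: integrable_pos_fin_num.
Qed.

End tuple_measure.

(** * Vanishing of the integral of a radial divergence *)

Section integral_radial_divergence.
Context {R : realType}.
Local Open Scope ereal_scope.
Local Notation mu n := (@lebesgue_tuple R n).

(** This is what remains of the weight [s^(n-1)] on [[1, 2]] once the dilation by [s] has
    contributed its Jacobian [s^-n]. The conclusion comes from dividing by its integral, which is
    why that integral must be nonzero. *)
Let inv12 (s : R) : R := (\1_`[1, 2] s * s^-1)%R.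

Let inv12E : EFin \o inv12 = (fun s : R => (s^-1)%:E) \_ `[1%R, 2%R].
Proof.
apply/funext => s; rewrite /= patchE /inv12 indicE.
by case: ifPn => _; rewrite ?mulr1n ?mulr0n ?mul1r ?mul0r.
Qed.

Let integrable_inv_12 : lebesgue_measure.-integrable `[1%R, 2%R]
  (EFin \o (fun s : R => s^-1)%R).
Proof.
apply: continuous_compact_integrable; first exact: segment_compact.
apply: continuous_in_subspaceT => s; rewrite inE /= in_itv /= => /andP[s1 _].
by apply: inv_continuous; rewrite gt_eqF// (lt_le_trans _ s1).
Qed.

Let integrable_inv12 : lebesgue_measure.-integrable setT (EFin \o inv12).
Proof. by rewrite inv12E; apply: (integrable_mkcond _ _).1. Qed.

Let integral_inv12_neq0 : \int[lebesgue_measure]_s (inv12 s)%:E != 0.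
Proof.
have -> : \int[lebesgue_measure]_s (inv12 s)%:E =
    \int[lebesgue_measure]_(s in `[1%R, 2%R]) (s^-1)%:E.
  by rewrite [RHS]integral_mkcond -inv12E.
rewrite gt_eqF// (@lt_le_trans _ _ (\int[lebesgue_measure]_(s in `[1%R, 2%R])
    cst (2^-1%:E : \bar R) s))//.
  rewrite integral_cst//= lebesgue_measure_itv /= lte_fin ltr1n -EFinB -EFinM
    lte_fin.
  by rewrite mulr_gt0//; lra.
apply: ge0_le_integral => //=.
- exact: measurable_int integrable_inv_12.
- move=> s; rewrite in_itv /= lee_fin => /andP[s1 s2].
  by rewrite lef_pV2 ?posrE//; exact: lt_le_trans s1.
Qed.

(* If [D] is the divergence of the field [x |-> a x *: x], then
   [s ^+ n.-1 * D (s x)] is the derivative of [s ^+ n * a (s x)], and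
   integrating over [x] the increment of the latter gives 0 by scaling. *)
Lemma integral_radial_div n (a D : n.-tuple R -> R) : (0 < n)%N ->
  (mu n).-integrable setT (EFin \o a) ->
  (mu n).-integrable setT (EFin \o D) ->
  (forall t, \int[lebesgue_measure]_(s in `[1%R, 2%R])
       (s ^+ n.-1 * D (scale_tuple s t))%:E =
     (2 ^+ n * a (scale_tuple 2 t))%:E - (a t)%:E) ->
  \int[mu n]_t (D t)%:E = 0.
Proof.
move=> n0 ia iD aD.
have mD : measurable_fun setT D by apply/measurable_EFinP;
  exact: measurable_int iD.
pose G (p : n.-tuple R * measurableTypeR R) : \bar R :=
  (\1_`[1%R, 2%R] p.2 * p.2 ^+ n.-1 * D (scale_tuple p.2 p.1))%:E.
have mG : measurable_fun setT G.
  apply/measurable_EFinP; apply: measurable_funM.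
    apply: measurable_funM.
      by apply: (measurableT_comp (f := \1_`[1%R, 2%R] : R -> R)).
    exact: (measurableT_comp (f := fun x : R => x ^+ n.-1)%R).
  exact: (measurableT_comp mD (@measurable_scale_tuple _ _)).
have snn s : s \in `[1%R, 2%R] -> (0 < s :> R)%R.
  by rewrite in_itv /= => /andP[s1 _]; exact: lt_le_trans s1.
have Gs (F : n.-tuple R -> \bar R) : (mu n).-integrable setT F -> forall s : R,
    \int[mu n]_t ((\1_`[1%R, 2%R] s * s ^+ n.-1)%:E * F (scale_tuple s t)) =
    (\1_`[1%R, 2%R] s * s^-1)%:E * \int[mu n]_t F t.
  move=> iF s; rewrite indicE; case: (boolP (s \in _)) => [|_]; last first.
    rewrite mulr0n; by under eq_integral do rewrite !mul0r mul0e;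
      rewrite integral0 !mul0r mul0e.
  rewrite inE /= => /snn s0; rewrite !mul1r integralZl//;
    last exact: integrable_scale.
  rewrite integral_scale// muleA -EFinM; congr (_%:E * _).
  by rewrite -[in X in (_ / X)%R](prednK n0) exprSr invfM mulrA divff ?mul1r//
    expf_neq0// gt_eqF.
have iabs : (mu n).-integrable setT (fun t => `|(D t)%:E|).
  exact: integrable_abse.
have k0 (s : R) : (0 <= \1_`[1%R, 2%R] s * s ^+ n.-1)%R.
  rewrite indicE; case: (boolP (s \in _)); last by rewrite mul0r.
  by rewrite inE /= => /snn s0; rewrite mul1r exprn_ge0// ltW.
(* By scaling, the iterated integral of [|G|] factors into the integral of [inv12] and that of
   [|D|], both finite. *)
have iG : (mu n \x lebesgue_measure).-integrable setT G.
  apply/(integrable21ltyP _ _ mG).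
  rewrite (_ : \int[_]_y _ = \int[lebesgue_measure]_s
      ((inv12 s)%:E * \int[mu n]_t `|(D t)%:E|)); last first.
    apply: eq_integral => s _; rewrite -(Gs _ iabs); apply: eq_integral => t _.
    by rewrite /G /= normrM ger0_norm.
  have Df := integrable_fin_num measurableT iabs.
  rewrite -(fineK Df) integralZr//.
  by rewrite ltey_eq fin_numM// integrable_fin_num.
have := Fubini iG.
under eq_integral => t _.
  rewrite (_ : \int[_]_y _ = (2 ^+ n * a (scale_tuple 2 t))%:E - (a t)%:E);
    last first.
    rewrite -aD [RHS]integral_mkcond; apply: eq_integral => s _.
    by rewrite /G /= patchE indicE; case: ifPn => _;
      rewrite ?mulr1n ?mulr0n ?mul1r// !mul0r.
  over.
rewrite integralB//; last first.
  by apply: (integrableZl _ _ (integrable_scale _ ia)).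
under eq_integral do rewrite EFinM.
rewrite integralZl//; last exact: (integrable_scale _ ia).
rewrite (integral_scale _ ia)// muleA -EFinM divff ?expf_neq0// mul1e subee;
  last first.
  exact: integrable_fin_num.
under eq_integral => s _.
  under eq_integral => t _ do rewrite /G /= EFinM.
  rewrite (Gs (EFin \o D))//.
  over.
have Df : \int[mu n]_t (D t)%:E \is a fin_num by exact: integrable_fin_num.
rewrite -(fineK Df) integralZr// => /esym/eqP; rewrite mule_eq0.
by rewrite (negbTE integral_inv12_neq0) => /eqP.
Qed.

End integral_radial_divergence.

(** * Integrability of the inverse square *)

Section inverse_square.
Context {R : realType}.
Local Open Scope ereal_scope.
Local Notation mu n := (@lebesgue_tuple R n).
Implicit Types n : nat.

Lemma sqnorm_scale n s (t : n.-tuple R) :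
  sqnorm (row_of (scale_tuple s t)) = (s ^+ 2 * sqnorm (row_of t))%R.
Proof.
rewrite /sqnorm mulr_sumr; apply: eq_bigr => i _.
by rewrite row_of_scale mxE exprMn.
Qed.

Lemma sqnorm_ge0 n (x : 'rV[R]_n) : (0 <= sqnorm x)%R.
Proof. by apply: sumr_ge0 => i _; exact: sqr_ge0. Qed.

Lemma measurable_sqnorm n : measurable_fun setT (fun t : n.-tuple R =>
  sqnorm (row_of t)).
Proof.
rewrite /sqnorm; under eq_fun do under eq_bigr do rewrite mxE.
by apply: measurable_sum => i; apply: measurable_funX; exact: measurable_tnth.
Qed.

Lemma measurable_sqnorm_lt n (c : R) :
  measurable [set t : n.-tuple R | (sqnorm (row_of t) < c)%R].
Proof.
rewrite -[X in measurable X]setTI.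
rewrite (_ : [set _ | _] = (fun t : n.-tuple R =>
  sqnorm (row_of t)) @^-1` `]-oo, c[).
  by apply: measurable_sqnorm.
by apply/seteqP; split => t /=; rewrite in_itv.
Qed.

Lemma sqnorm_lt_finite n (c : R) :
  mu n [set t | (sqnorm (row_of t) < c)%R] < +oo.
Proof.
have mI : measurable (`[- (1 + `|c|), 1 + `|c|]%classic%R : set R) by [].
apply: (@le_lt_trans _ _ (lebesgue_measure (`[- (1 + `|c|),
  1 + `|c|]%classic%R : set R) ^+ n)).
  rewrite -lebesgue_tuple_all//; apply: le_measure; rewrite ?inE//.
  - exact: measurable_sqnorm_lt.
  - exact: measurable_all_tnth.
  - move=> t /= tc i; rewrite in_itv /= -ler_norml.
    have : (tnth t i ^+ 2 < c)%R.
      apply: le_lt_trans tc; rewrite /sqnorm (bigD1 i)//= mxE lerDl.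
      by apply: sumr_ge0 => j _; exact: sqr_ge0.
    rewrite -real_normK ?num_real// => h.
    have := ler_norm c; have := normr_ge0 (tnth t i); nra.
rewrite lebesgue_measure_itv /=; case: ifPn => _; last by case: n => [|n];
  rewrite ?expe0 ?ltry// expeS mul0e.
by rewrite -EFinB -EFin_expe ltry.
Qed.

(* The integral I of a truncation of |x|^-2 over the unit ball satisfies
   2^n I <= 4 I + 4 |B_2| by dilation by 2, hence I <= |B_2| if n >= 3. The
   factor [n.-2] makes the statement trivial for n <= 2. *)
Lemma integrable_inv_sqnorm n :
  (mu n).-integrable [set t | (sqnorm (row_of t) < 1)%R]
    (fun t => (n.-2%:R * (sqnorm (row_of t))^-1)%:E).
Proof.
have [n2|n3] := leqP n 2.
  have -> : n.-2 = 0%N by apply/eqP; rewrite -subn2 subn_eq0.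
  rewrite (_ : (fun _ => _) = cst 0); first exact: integrable0.
  by apply/funext => t /=; rewrite mul0r.
pose B c : set (n.-tuple R) := [set t | (sqnorm (row_of t) < c)%R].
have mB c : measurable (B c) := @measurable_sqnorm_lt n c.
have mI c : measurable_fun setT (\1_(B c) : n.-tuple R -> R).
  exact: measurable_indic.
pose q (t : n.-tuple R) : R := ((sqnorm (row_of t))^-1)%R.
have q0 t : (0 <= q t)%R by rewrite invr_ge0 sqnorm_ge0.
have mq : measurable_fun setT q.
  rewrite (_ : q = fun t => sqnorm (row_of t) `^ (- 1))%R; last first.
    by apply/funext => t; rewrite powR_inv1// sqnorm_ge0.
  exact: (measurableT_comp (measurable_powR _) (@measurable_sqnorm _)).
(* The truncation makes the integral finite, so that it can be subtracted from both sides of the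
   dilation inequality; monotone convergence removes it at the end. *)
pose F (M : nat) (t : n.-tuple R) : R := (\1_(B 1%R) t * Num.min (q t) M%:R)%R.
have mF M : measurable_fun setT (F M).
  by apply: measurable_funM; [|exact: measurable_minr].
have F0 M t : (0 <= F M t)%R.
  by rewrite mulr_ge0// le_min q0 ler0n.
have mu1 c : \int[mu n]_t (\1_(B c) t)%:E = mu n (B c).
  by rewrite integral_indic ?setIT.
have Vfin : mu n (B 4%R) < +oo by exact: sqnorm_lt_finite.
have Ffin M : \int[mu n]_t (F M t)%:E < +oo.
  apply: (@le_lt_trans _ _ (\int[mu n]_t (M%:R%:E * (\1_(B 1%R) t)%:E))).
    apply: ge0_le_integral => //.
    - by move=> t _; rewrite lee_fin F0.
    - exact/measurable_EFinP.
    - by apply/measurable_EFinP; apply: measurable_funM.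
    - move=> t _; rewrite -EFinM lee_fin /F mulrC ler_wpM2r// ge_min lexx
      orbT//.
  rewrite ge0_integralZl//; last by apply/measurable_EFinP.
  by rewrite mu1 lte_mul_pinfty//; exact: sqnorm_lt_finite.
(* [B c] is cut out by the squared norm, so [B 4] is the ball of radius 2, the dilate of [B 1]. On
   [B 1], [min (4 q) M <= 4 min q M]; on the rest of [B 4], [q <= 1]. *)
have F2 M t : (F M (scale_tuple 2^-1 t) <= 4 * F M t + 4 * \1_(B 4%R) t)%R.
  have -> : F M (scale_tuple 2^-1 t) = (\1_(B 4%R) t * Num.min (4 * q t)
    M%:R)%R.
    have four : (2 ^+ 2 = 4 :> R)%R by rewrite -natrX.
    rewrite /F /q /B !indicE sqnorm_scale invfM exprVn invrK.
    rewrite four; congr ((nat_of_bool _)%:R * _)%R; apply/idP/idP;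
      rewrite !inE /= sqnorm_scale;
      rewrite exprVn four; lra.
  rewrite /F !indicE; case: (boolP (t \in B 4%R)) => [t4|_]; last first.
    by rewrite mulr0n mul0r mulr0 addr0 mulr_ge0// F0.
  rewrite mulr1n mul1r mulr1; case: (boolP (t \in B 1%R)) => [_|].
    rewrite mul1r; have := ler0n R M; move: (M%:R : R) (q t) (q0 t) =>
      m a a0 m0.
    by rewrite /Order.min; do 2 case: ifPn; rewrite -?leNgt; lra.
  rewrite mulr0n mul0r mulr0 add0r => /negP t1.
  rewrite ge_min; apply/orP; left.
  have : (1 <= sqnorm (row_of t))%R.
    by rewrite leNgt; apply/negP => t1'; apply: t1; rewrite inE.
  move=> s1; rewrite -[leRHS]mulr1 ler_pM2l// /q invf_le1//.
  exact: lt_le_trans s1.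
have FV M : \int[mu n]_t (F M t)%:E <= mu n (B 4%R).
  (* The dilation produces the factor [2^n], at least 8 because [n >= 3]. A factor 4, as in the
     plane, would leave nothing after subtraction. *)
  have : 8%:E * \int[mu n]_t (F M t)%:E <=
         4%:E * \int[mu n]_t (F M t)%:E + 4%:E * mu n (B 4%R).
    apply: (@le_trans _ _ ((2^-1 ^- n)%:E * \int[mu n]_t (F M t)%:E)).
      apply: lee_wpmul2r; first by apply: integral_ge0 => t _; rewrite lee_fin.
      rewrite lee_fin exprVn invrK (_ : 8 = 2 ^+ 3 :> R)%R; last
        by rewrite -natrX.
      by rewrite ler_eXn2l// ltr1n.
    have mFe := (measurable_EFinP _ _).2 (mF M).
    have mIe := (measurable_EFinP _ _).2 (mI 4%R).
    rewrite -(@ge0_integral_scale _ n 2^-1 (EFin \o F M))//; last first.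
      by move=> t; rewrite /= lee_fin.
    rewrite -mu1 -!ge0_integralZl//; last first.
      by move=> t _; rewrite lee_fin.
    rewrite -ge0_integralD//; last 3 first.
    - by move=> t _; rewrite -EFinM lee_fin mulr_ge0.
    - exact: measurable_funeM.
    - exact: measurable_funeM.
    apply: ge0_le_integral => //.
    - by move=> t _; rewrite /= lee_fin.
    - exact: (measurableT_comp mFe (@measurable_scale_tupler _ _ _)).
    - by apply: emeasurable_funD; exact: measurable_funeM.
    - by move=> t _; rewrite -!EFinM -EFinD lee_fin.
  have := Ffin M; have : 0 <= \int[mu n]_t (F M t)%:E.
    by apply: integral_ge0 => t _; rewrite lee_fin.
  have V0 : 0 <= mu n (B 4%R) by [].
  move: V0 Vfin;
  case: (\int[mu n]_t (F M t)%:E) => // r; case: (mu n (B 4%R)) => // v.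
  by rewrite -!EFinM -EFinD !lee_fin => *; lra.
have Fq t : (fun M => (F M t)%:E) @ \oo --> (\1_(B 1%R) t * q t)%:E.
  apply: cvg_near_cst; near=> k.
  rewrite /F (min_idPl _)//; near: k; exact: nbhs_infty_ger.
have ndF t : nondecreasing_seq (fun M => (F M t)%:E).
  move=> k k' kk'; rewrite lee_fin ler_wpM2l//.
  by rewrite le_min !ge_min lexx /= ler_nat kk' orbT.
have Iq : \int[mu n]_t (\1_(B 1%R) t * q t)%:E < +oo.
  apply: le_lt_trans Vfin.
  under eq_integral do rewrite -(cvg_lim (@ereal_hausdorff R) (Fq _))//.
  rewrite monotone_convergence//; last 2 first.
  - by move=> M; exact/measurable_EFinP.
  - by move=> M t _; rewrite lee_fin.
  apply: lime_le; last exact: nearW.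
  apply: ereal_nondecreasing_is_cvgn => M M' MM'; apply: ge0_le_integral => //.
  - by move=> t _; rewrite lee_fin.
  - exact/measurable_EFinP.
  - exact/measurable_EFinP.
  - by move=> t _; exact: ndF.
have Q t : (n.-2%:R * q t)%:E = n.-2%:R%:E * (q t)%:E by rewrite EFinM.
apply/integrableP; split.
  apply/measurable_EFinP; apply: measurable_funTS.
  by apply: measurable_funM => //; exact: mq.
under eq_integral => t _.
  rewrite -/(q t) Q abseM /= (ger0_norm (q0 t)) ger0_norm//.
  over.
rewrite ge0_integralZl//; last 2 first.
- by apply/measurable_EFinP; exact: measurable_funTS.
- by move=> t _; rewrite lee_fin.
apply: lte_mul_pinfty => //; rewrite integral_mkcond.
rewrite (_ : _ \_ _ = fun t => (\1_(B 1%R) t * q t)%:E)//.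
apply/funext => t; rewrite patchE indicE; case: ifPn => _.
  by rewrite mulr1n mul1r.
by rewrite mulr0n mul0r.
Unshelve. all: by [exact: mB|end_near]. Qed.

End inverse_square.

(** * Directional derivatives *)

Section is_derive_pointwise.
Context {R : realType} {V : normedModType R}.
Implicit Types (f g : V -> R) (x v : V).

(** Restriction to a line lets the one-variable chain rule act on directional derivatives without a
    differential at [x]. *)
Lemma is_derive_line f x v (d : R) :
  is_derive x v f d <-> is_derive (0 : R) 1 (fun h => f (h *: v + x)) d.
Proof.
have E : 'D_v f x = 'D_1 (fun h : R => f (h *: v + x)) 0.
  rewrite /derive; set g1 := fun h => h^-1 *: _; set g2 := fun h => h^-1 *: _.
  suff -> : g1 = g2 by [].
  by apply/funext => h; rewrite /g1 /g2 /= addr0 scale0r add0r [_%:A]mulr1.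
by split=> -[fd <-]; split; rewrite ?E//;
  [exact: (derivable1P f x v).1|exact: (derivable1P f x v).2].
Qed.

Lemma is_derive_chain f (g : R -> R) x v (df dg : R) : is_derive x v f df ->
  is_derive (f x) 1 g dg -> is_derive x v (fun z => g (f z)) (dg * df).
Proof.
move=> /is_derive_line fx gfx; apply/is_derive_line.
apply: (@is_derive1_comp _ g (fun h => f (h *: v + x)) 0 dg df) => //.
by rewrite scale0r add0r.
Qed.

Lemma is_derive_add f g x v (df dg : R) : is_derive x v f df ->
  is_derive x v g dg -> is_derive x v (fun z => f z + g z) (df + dg).
Proof. exact: is_deriveD. Qed.

Lemma is_derive_sub f g x v (df dg : R) : is_derive x v f df ->
  is_derive x v g dg -> is_derive x v (fun z => f z - g z) (df - dg).
Proof. exact: is_deriveB. Qed.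

Lemma is_derive_mul f g x v (df dg : R) : is_derive x v f df ->
  is_derive x v g dg -> is_derive x v (fun z =>
    f z * g z) (df * g x + f x * dg).
Proof.
move=> fx gx; apply: is_derive_eq (is_deriveM fx gx) _.
by rewrite /GRing.scale /= addrC [g x * _]mulrC.
Qed.

Lemma is_derive_inv f x v (df : R) : f x != 0 -> is_derive x v f df ->
  is_derive x v (fun z => (f z)^-1) (- df / f x ^+ 2).
Proof.
move=> fx0 [fx <-]; split; first exact: derivableV.
by rewrite deriveV// /GRing.scale /= mulrC mulrN mulNr.
Qed.

Lemma is_derive_div f g x v (df dg : R) : g x != 0 -> is_derive x v f df ->
  is_derive x v g dg ->
  is_derive x v (fun z => f z / g z) ((df * g x - f x * dg) / g x ^+ 2).
Proof.
move=> gx0 fx gx; apply: is_derive_eq (is_derive_mul fx (is_derive_inv gx0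
  gx)) _.
by field.
Qed.

Lemma is_derive_const (k : R) x v : is_derive x v (fun _ => k) 0.
Proof. exact: is_derive_cst. Qed.

Lemma is_derive_sqr f x v (df : R) : is_derive x v f df ->
  is_derive x v (fun z => f z ^+ 2) (2 * f x * df).
Proof.
move=> fx; rewrite (_ : (fun z => _) = fun z => f z * f z); last first.
  by apply/funext => z; rewrite expr2.
by apply: is_derive_eq (is_derive_mul fx fx) _; ring.
Qed.

Lemma is_derive_bigsum (I : Type) (r : seq I) (F : I -> V -> R) (dF : I -> R)
  x v :
  (forall i, is_derive x v (F i) (dF i)) ->
  is_derive x v (fun z => \sum_(i <- r) F i z) (\sum_(i <- r) dF i).
Proof.
move=> FdF; elim: r => [|i r IH].
  rewrite big_nil; under eq_fun do rewrite big_nil; exact: is_derive_const.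
rewrite big_cons; under eq_fun do rewrite big_cons.
exact: is_derive_add.
Qed.

End is_derive_pointwise.

(** * Euclidean geometry and calculus on row vectors *)

Section row_calculus.
Context {R : realType} {n : nat}.
Implicit Types (x y u v : 'rV[R]_n) (c : R -> 'rV[R]_n) (f : 'rV[R]_n -> R).

Definition dotr x y : R := \sum_i x 0 i * y 0 i.

Lemma is_derive_coordP (V : normedModType R) (c : V -> 'rV[R]_n) (t w : V) u :
  is_derive t w c u <-> forall i, is_derive t w (fun s => c s 0 i) (u 0 i).
Proof.
split => [[ct <-] i|cu].
  split; first exact: (derivable_mxP _ _ _).1.
  by rewrite derive_mx// mxE.
have ct : derivable c t w.
  by apply/derivable_mxP => i j; rewrite ord1; have [] := cu j.
split=> //; rewrite derive_mx//; apply/rowP => i; rewrite mxE.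
by have [] := cu i.
Qed.

Lemma is_derive_dotr (V : normedModType R) (c d : V -> 'rV[R]_n) (t w : V) dc
  dd :
  is_derive t w c dc -> is_derive t w d dd ->
  is_derive t w (fun s => dotr (c s) (d s)) (dotr dc (d t) + dotr (c t) dd).
Proof.
move=> /is_derive_coordP cd /is_derive_coordP ddd.
rewrite /dotr -big_split; apply: is_derive_bigsum => i.
exact: is_derive_mul.
Qed.

Lemma dotrC x y : dotr x y = dotr y x.
Proof. by apply: eq_bigr => i _; rewrite mulrC. Qed.

Lemma dotr_sqnorm x : dotr x x = sqnorm x.
Proof. by apply: eq_bigr => i _; rewrite expr2. Qed.

Lemma is_derive_sqnorm (V : normedModType R) (c : V -> 'rV[R]_n) (t w : V) dc :
  is_derive t w c dc ->
  is_derive t w (fun s => sqnorm (c s)) (2 * dotr (c t) dc).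
Proof.
move=> cd; rewrite (_ : (fun s => _) = fun s => dotr (c s) (c s)); last first.
  by apply/funext => s; rewrite dotr_sqnorm.
apply: is_derive_eq (is_derive_dotr cd cd) _.
by rewrite [dotr dc _]dotrC mulr2n mulrDl mul1r.
Qed.

Lemma dotrZl a x y : dotr (a *: x) y = a * dotr x y.
Proof. by rewrite /dotr mulr_sumr; apply: eq_bigr => i _; rewrite mxE mulrA.
  Qed.

Lemma dotrZr a x y : dotr x (a *: y) = a * dotr x y.
Proof. by rewrite dotrC dotrZl dotrC. Qed.

Lemma sqnormZ a x : sqnorm (a *: x) = a ^+ 2 * sqnorm x.
Proof. by rewrite /sqnorm mulr_sumr; apply: eq_bigr => i _;
  rewrite mxE exprMn. Qed.

Lemma sqnorm_eq0 x : (sqnorm x == 0) = (x == 0).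
Proof.
apply/idP/eqP => [|->]; last by rewrite /sqnorm big1// => i _;
  rewrite mxE expr0n.
rewrite psumr_eq0 => [/allP x0|i _]; last exact: sqr_ge0.
by apply/rowP => i; have := x0 i (mem_index_enum i); rewrite sqrf_eq0 mxE =>
  /eqP.
Qed.

Lemma sqr_dotr_le x y : dotr x y ^+ 2 <= sqnorm x * sqnorm y.
Proof.
have [->|y0] := eqVneq y 0.
  rewrite /dotr big1 ?expr0n//= => [|i _]; last by rewrite mxE mulr0.
  by rewrite mulr_ge0// sqnorm_ge0.
have q0 : 0 < sqnorm y by rewrite lt_neqAle eq_sym sqnorm_eq0 y0 sqnorm_ge0.
(* This vector is [|y|^2] times the component of [x] orthogonal to [y]; the scaling avoids a
   division. *)
have : 0 <= sqnorm (sqnorm y *: x - dotr x y *: y) by exact: sqnorm_ge0.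
have -> : sqnorm (sqnorm y *: x - dotr x y *: y) =
    sqnorm y * (sqnorm x * sqnorm y - dotr x y ^+ 2).
  transitivity (\sum_i (sqnorm y ^+ 2 * x 0 i ^+ 2
      - 2 * sqnorm y * dotr x y * (x 0 i * y 0 i) + dotr x y ^+ 2 * y 0 i ^+
        2)).
    by apply: eq_bigr => i _; rewrite !mxE; ring.
  rewrite big_split /= sumrB -!mulr_sumr -/(sqnorm x) -/(sqnorm y) -/(dotr x y).
  by ring.
by rewrite pmulr_rge0// subr_ge0.
Qed.

Lemma diff_partial f x v : differentiable f x ->
  'd f x v = \sum_i v 0 i * partial i f x.
Proof.
move=> fx; rewrite {1}(row_sum_delta v) linear_sum; apply: eq_bigr => i _.
by rewrite linearZ /= /partial deriveE.
Qed.

Lemma is_derive_comp_curve f c t u : differentiable f (c t) ->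
  is_derive t 1 c u ->
  is_derive t 1 (f \o c) (\sum_i u 0 i * partial i f (c t)).
Proof.
move=> fct [/derivable1_diffP ct ctu].
have d : differentiable (f \o c) t by exact: differentiable_comp.
split; first exact/derivable1_diffP.
have cu : 'd c t 1 = u by rewrite -ctu deriveE.
by rewrite deriveE// diff_comp//= cu diff_partial.
Qed.

Lemma differentiable_sqnorm x : differentiable (@sqnorm R n) x.
Proof.
rewrite (_ : sqnorm = \sum_i (fun z : 'rV[R]_n => z 0 i) ^+ 2); last first.
  by apply/funext => z; rewrite fct_sumE.
by apply: differentiable_sum => i; apply: differentiableX;
  exact: differentiable_coord.
Qed.

Lemma continuous_sqnorm : continuous (@sqnorm R n).
Proof. by move=> x; apply: differentiable_continuous;
  exact: differentiable_sqnorm. Qed.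

Lemma open_poincare_ball : open (@poincare_ball R n).
Proof.
rewrite (_ : poincare_ball = @sqnorm R n @^-1` [set r | r < 1])//.
apply: open_comp; last exact: open_lt.
by move=> x _; exact: continuous_sqnorm.
Qed.

End row_calculus.

(** * The hyperbolic distance from the origin *)

Section ball_metric.
Context {R : realType} {N : nat}.
Implicit Types (x v w : 'rV[R]_N) (f : 'rV[R]_N -> R).

Lemma hinnerE x v w : hinner x v w = 4 / (1 - sqnorm x) ^+ 2 * dotr v w.
Proof.
rewrite /hinner /hmetric mul_mx_scalar -scalemxAl !mxE; congr (_ * _).
by apply: eq_bigr => i _; rewrite mxE.
Qed.

Lemma hnorm_sqr x v : poincare_ball x ->
  hnorm x v ^+ 2 = 4 / (1 - sqnorm x) ^+ 2 * sqnorm v.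
Proof.
move=> xB; rewrite /hnorm sqr_sqrtr hinnerE dotr_sqnorm//.
by rewrite mulr_ge0 ?sqnorm_ge0// divr_ge0// sqr_ge0.
Qed.

Lemma hnormE x v : poincare_ball x ->
  hnorm x v = 2 / (1 - sqnorm x) * Num.sqrt (sqnorm v).
Proof.
move=> xB; have q0 : 0 < 1 - sqnorm x by rewrite subr_gt0.
have h0 : 0 <= 2 / (1 - sqnorm x) by rewrite divr_ge0// ltW.
rewrite /hnorm hinnerE dotr_sqnorm sqrtrM ?divr_ge0 ?sqr_ge0//; congr (_ * _).
by rewrite -[RHS]ger0_norm// -sqrtr_sqr expr_div_n -natrX.
Qed.

Lemma hnorm_hgrad_sqr f x : poincare_ball x ->
  hnorm x (hgrad f x) ^+ 2 =
  (1 - sqnorm x) ^+ 2 / 4 * \sum_i partial i f x ^+ 2.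
Proof.
move=> xB; have q0 : 0 < 1 - sqnorm x by rewrite subr_gt0.
rewrite hnorm_sqr// /hgrad /hmetric invmx_scalar mul_mx_scalar sqnormZ.
rewrite (_ : sqnorm (\row_i partial i f x) = \sum_i partial i f x ^+ 2);
  last first.
  by apply: eq_bigr => i _; rewrite mxE.
rewrite invf_div; move: (1 - _) (gt_eqF q0) => d d0.
by field; rewrite d0.
Qed.

Lemma sqrt_det_hmetric x : poincare_ball x ->
  Num.sqrt (\det (hmetric x)) = (2 / (1 - sqnorm x)) ^+ N.
Proof.
move=> xB; have q0 : 0 < 1 - sqnorm x by rewrite subr_gt0.
have h0 : 0 <= 2 / (1 - sqnorm x) by rewrite divr_ge0// ltW.
rewrite /hmetric det_scalar -[RHS]ger0_norm ?exprn_ge0// -sqrtr_sqr.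
by rewrite [in RHS]exprAC (expr_div_n 2) -natrX.
Qed.

Definition enorm x : R := Num.sqrt (sqnorm x).

Lemma enorm_ge0 x : 0 <= enorm x. Proof. exact: sqrtr_ge0. Qed.

Lemma enorm_sqr x : enorm x ^+ 2 = sqnorm x.
Proof. by rewrite sqr_sqrtr// sqnorm_ge0. Qed.

Lemma enorm_lt1 x : poincare_ball x -> enorm x < 1.
Proof.
move=> xB; rewrite -[ltRHS]sqrtr1 ltr_sqrt//; exact: xB.
Qed.

(** Twice the inverse hyperbolic tangent, that is, the hyperbolic length of a radial segment of
    Euclidean length [r]. *)
Definition artanh2 (r : R) : R := ln ((1 + r) / (1 - r)).

Lemma is_derive_artanh2 (r : R) : -1 < r < 1 -> is_derive r 1 artanh2 (2 / (1
  - r ^+ 2)).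
Proof.
move=> /andP[r1 r2]; have rp : 0 < 1 + r by lra.
have rm : 0 < 1 - r by lra.
have d1 : is_derive r 1 (fun s : R => (1 + s) / (1 - s)) (2 / (1 - r) ^+ 2).
  apply: is_derive_eq (is_derive_div _ (is_derive_add (is_derive_const _ _ _)
    (is_derive_id _ _))
    (is_derive_sub (is_derive_const _ _ _) (is_derive_id _ _))) _; first
      by rewrite gt_eqF.
  by field; rewrite gt_eqF.
apply: is_derive_eq (is_derive_chain d1 (is_derive1_ln _)) _.
  by rewrite divr_gt0.
rewrite invf_div; have -> : 1 - r ^+ 2 = (1 - r) * (1 + r) by ring.
by field; rewrite !gt_eqF.
Qed.

Lemma artanh2_0 : artanh2 0 = 0.
Proof. by rewrite /artanh2 addr0 subr0 divr1 ln1. Qed.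

Lemma Rintegral_derive01 (F k : R -> R) :
  (forall t : R, 0 <= t <= 1 -> is_derive t 1 F (k t)) ->
  {within `[0, 1], continuous k} ->
  (\int[lebesgue_measure]_(t in `[0, 1]) k t)%R = F 1 - F 0.
Proof.
move=> Fk ck; rewrite /Rintegral (@continuous_FTC2 _ _ F)//.
- split => [t|/=|/=].
  + by rewrite in_itv /= => /andP[t0 t1]; have [|] := Fk t; rewrite ?ltW.
  + apply: cvg_at_right_filter; apply: differentiable_continuous.
    by apply/derivable1_diffP; have [|] := Fk 0; rewrite ?lexx ?ler01.
  + apply: cvg_at_left_filter; apply: differentiable_continuous.
    by apply/derivable1_diffP; have [|] := Fk 1; rewrite ?lexx ?ler01.
- move=> t; rewrite in_itv /= => /andP[t0 t1].
  by have [|_] := Fk t; rewrite ?ltW// derive1E.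
Qed.

Lemma continuous_within_hspeed (c : R -> 'rV[R]_N) :
  (forall t, 0 <= t <= 1 -> poincare_ball (c t) /\ derivable c t 1) ->
  {within `[0, 1], continuous (derive1 c)} ->
  {within `[0, 1], continuous
    (fun t => 2 / (1 - sqnorm (c t)) * Num.sqrt (sqnorm (derive1 c t)))}.
Proof.
move=> cB /subspace_continuousP cc; apply/subspace_continuousP => t t01.
have [ct dct] : poincare_ball (c t) /\ derivable c t 1.
  by apply: cB; move: t01; rewrite /= in_itv.
have cq : sqnorm (c s) @[s --> within `[0, 1] (nbhs t)] --> sqnorm (c t).
  have c_t : c s @[s --> t] --> c t.
    exact/differentiable_continuous/derivable1_diffP.
  by apply: cvg_within_filter;
    exact: (cvg_comp _ _ c_t (@continuous_sqnorm _ _ _)).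
apply: cvgM.
  apply: cvgM; first exact: cvg_cst.
  apply: cvgV; first by rewrite gt_eqF// subr_gt0.
  by apply: cvgB => //; exact: cvg_cst.
have c't := cvg_comp _ _ (cc _ t01) (@continuous_sqnorm _ _ _).
exact: (cvg_comp _ _ c't (@sqrt_continuous R _)).
Qed.

(* The radial projection [p] of a curve onto the direction of its endpoint
   satisfies [|p'| <= |c'|] and [1 - p^2 >= 1 - |c|^2], which bounds the length
   below without ever differentiating the norm at the origin. *)
Lemma hlength_ge c x : is_C1_path 0 x c -> artanh2 (enorm x) <= hlength c.
Proof.
move=> [cB cc c0 c1].
pose u := (enorm x)^-1 *: x.
(* When [x = 0] the inverse is 0 and [u = 0], whence an inequality; it is all that the projection
   estimate requires. *)
have u1 : sqnorm u <= 1.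
  rewrite sqnormZ -enorm_sqr -exprMn.
  have [->|x0] := eqVneq (enorm x) 0; first by rewrite mulr0 expr0n.
  by rewrite mulVf// expr1n.
have xu : dotr x u = enorm x.
  rewrite dotrZr dotr_sqnorm -enorm_sqr.
  have [->|x0] := eqVneq (enorm x) 0; first by rewrite expr0n mulr0.
  by rewrite expr2 mulrA mulVf// mul1r.
have dot_le v : dotr v u ^+ 2 <= sqnorm v.
  by rewrite (le_trans (sqr_dotr_le _ _))// ler_piMr// sqnorm_ge0.
pose p t := dotr (c t) u.
pose k t := 2 / (1 - p t ^+ 2) * dotr (derive1 c t) u.
have p1 t : 0 <= t <= 1 -> p t ^+ 2 <= sqnorm (c t) /\ sqnorm (c t) < 1.
  by move=> /cB[ct _]; split => //; exact: dot_le.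
have dp (t : R) : 0 <= t <= 1 -> is_derive t 1 p (dotr (derive1 c t) u).
  move=> /cB[_ /derivableP ct].
  apply: is_derive_eq (is_derive_dotr ct (is_derive_cst _ _ _)) _.
  rewrite derive1E (_ : dotr (c t) 0 = 0) ?addr0//.
  by rewrite /dotr big1// => i _; rewrite mxE mulr0.
have dF (t : R) : 0 <= t <= 1 -> is_derive t 1 (fun s => artanh2 (p s)) (k t).
  move=> t01; apply: is_derive_chain (dp t t01) _; apply: is_derive_artanh2.
  by have [] := p1 _ t01 => *; apply/andP; split; nra.
have ck : {within `[0, 1], continuous k}.
  apply/subspace_continuousP => t t01.
  have t01' : 0 <= t <= 1 by move: t01; rewrite /= in_itv.
  have cdot : continuous (fun v : 'rV[R]_N => dotr v u).
    move=> v; apply: differentiable_continuous.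
    rewrite (_ : (fun _ => _) = \sum_i (fun z : 'rV[R]_N =>
      z 0 i) * cst (u 0 i)).
      apply: differentiable_sum => i.
      by apply: differentiableM => //; exact: differentiable_coord.
    by apply/funext => z; rewrite fct_sumE.
  have cp : p s @[s --> within `[0, 1] (nbhs t)] --> p t.
    apply: cvg_within_filter; apply: differentiable_continuous.
    by apply/derivable1_diffP; have [] := dp t t01'.
  apply: cvgM; last first.
    move/subspace_continuousP : cc => cc.
    exact: (cvg_comp _ _ (cc _ t01) (@cdot _)).
  apply: cvgM; first exact: cvg_cst.
  apply: cvgV; last by apply: cvgB; [exact: cvg_cst|];
    exact: (cvg_comp _ _ cp (@exprn_continuous _ 2 _)).
  by have [] := p1 _ t01' => *; rewrite gt_eqF//; nra.
have := Rintegral_derive01 dF ck.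
rewrite /p c0 c1 xu /dotr big1 ?artanh2_0 ?subr0 => [<-|i _]; last first.
  by rewrite mxE mul0r.
have -> : hlength c = (\int[lebesgue_measure]_(t in `[0, 1])
    (2 / (1 - sqnorm (c t)) * Num.sqrt (sqnorm (derive1 c t))))%R.
  by apply: eq_Rintegral => t; rewrite inE /= in_itv /= => /cB[ct _];
    rewrite hnormE.
apply: le_Rintegral => //.
- by apply: continuous_compact_integrable => //; exact: segment_compact.
- apply: continuous_compact_integrable; first exact: segment_compact.
  exact: continuous_within_hspeed.
move=> t; rewrite /= in_itv /= => t01; have [pt ct] := p1 _ t01.
have d0 : 0 < 1 - sqnorm (c t) by rewrite subr_gt0.
have d1 : 0 < 1 - p t ^+ 2 by lra.
apply: (@le_trans _ _ (2 / (1 - p t ^+ 2) * Num.sqrt (sqnorm (derive1 c t)))).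
  rewrite ler_wpM2l//; first by rewrite divr_ge0// ltW.
  by rewrite (le_trans (ler_norm _))// -sqrtr_sqr ler_wsqrtr.
by rewrite ler_wpM2r ?sqrtr_ge0// ler_pM2l// lef_pV2// lerD2l lerN2.
Qed.

End ball_metric.

Section distance.
Context {R : realType} {N : nat}.
Implicit Types (x : 'rV[R]_N).

Lemma is_derive_scale_line (V : normedModType R) (g : V -> R) (t w : V) dg x :
  is_derive t w g dg -> is_derive t w (fun s => g s *: x) (dg *: x).
Proof.
move=> gt; apply/is_derive_coordP => i; rewrite mxE.
under eq_fun do rewrite mxE.
by apply: is_derive_eq (is_derive_mul gt (is_derive_const _ _ _)) _;
  rewrite mulr0 addr0.
Qed.

Lemma is_derive_segment x (t : R) : is_derive t 1 (fun s : R => s *: x) x.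
Proof.
by apply: is_derive_eq (is_derive_scale_line _ (is_derive_id _ _)) _;
  rewrite scale1r.
Qed.

Lemma derive1_segment x : derive1 (fun s : R => s *: x) = cst x.
Proof. by apply/funext => t; rewrite derive1E;
  have [] := is_derive_segment x t. Qed.

Lemma is_C1_path_segment x : poincare_ball x ->
  is_C1_path 0 x (fun s : R => s *: x).
Proof.
move=> xB; split.
- move=> t /andP[t0 t1]; split; last by have [] := is_derive_segment x t.
  rewrite /poincare_ball /= sqnormZ.
  by apply: le_lt_trans xB; rewrite ler_piMl ?sqnorm_ge0// expr_le1.
- rewrite derive1_segment; apply: continuous_subspaceT => t; exact: cvg_cst.
- by rewrite scale0r.
- by rewrite scale1r.
Qed.

Lemma hlength_segment x : poincare_ball x ->
  hlength (fun s : R => s *: x) = artanh2 (enorm x).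
Proof.
move=> xB; have [cB cc _ _] := is_C1_path_segment xB.
have -> : hlength (fun s : R => s *: x) = (\int[lebesgue_measure]_(t in `[0%R,
  1%R])
    (2 / (1 - sqnorm (t *: x)) * Num.sqrt (sqnorm (derive1 (fun s : R =>
      s *: x) t))))%R.
  by apply: eq_Rintegral => t; rewrite inE /= in_itv /= => /cB[ct _];
    rewrite hnormE.
apply: etrans (Rintegral_derive01 (F := fun t => artanh2 (t * enorm x)) _ _) _.
- move=> t /andP[t0 t1]; rewrite derive1_segment -/(enorm x).
  have [e0 e1] := (enorm_ge0 x, enorm_lt1 xB).
  apply: is_derive_eq (is_derive_chain (df := enorm x) _ (is_derive_artanh2
    _)) _.
  + by apply: is_derive_eq (is_derive_mul (is_derive_id _ _) (is_derive_const
    _ _ _)) _;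
      rewrite mulr0 addr0 mul1r.
  + by apply/andP; split; nra.
  + by rewrite sqnormZ -enorm_sqr exprMn.
- exact: continuous_within_hspeed.
- by rewrite mul1r mul0r artanh2_0 subr0.
Qed.

Lemma rhoE x : poincare_ball x -> rho x = artanh2 (enorm x).
Proof.
move=> xB; apply/eqP; rewrite eq_le; apply/andP; split.
- apply: ge_inf; first by exists (artanh2 (enorm x)) => _ [c xc <-];
  exact: hlength_ge.
  exists (fun s : R => s *: x); first exact: is_C1_path_segment.
  exact: hlength_segment.
- apply: lb_le_inf; last by move=> _ [c xc <-]; exact: hlength_ge.
  by exists (hlength (fun s : R => s *: x)), (fun s : R => s *: x) => //;
    exact: is_C1_path_segment.
Qed.

End distance.

(** * Conversion between Euclidean radius and hyperbolic distance *)

Section artanh2_theory.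
Context {R : realType}.
Implicit Types r t : R.

(** This is [tanh (t/2)], the inverse of [artanh2]: the Euclidean radius at hyperbolic distance
    [t]. *)
Definition tanh_half t : R := (expR t - 1) / (expR t + 1).

Lemma artanh2_gt0 r : 0 < r < 1 -> 0 < artanh2 r.
Proof.
move=> /andP[r0 r1]; rewrite ln_gt0// ltr_pdivlMr ?subr_gt0// mul1r; lra.
Qed.

Lemma expR_artanh2 r : -1 < r < 1 -> expR (artanh2 r) = (1 + r) / (1 - r).
Proof. by move=> /andP[r0 r1]; rewrite lnK// posrE divr_gt0//; lra. Qed.

Lemma artanh2K r : -1 < r < 1 -> tanh_half (artanh2 r) = r.
Proof.
move=> r1; rewrite /tanh_half expR_artanh2//; move: r1 => /andP[r0 r1].
have r1' : 1 - r != 0 by rewrite gt_eqF//; lra.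
by field; rewrite r1'/= gt_eqF//; lra.
Qed.

Lemma sinh_artanh2 r : -1 < r < 1 -> sinh (artanh2 r) = 2 * r / (1 - r ^+ 2).
Proof.
move=> r1; rewrite /sinh expRN expR_artanh2//; move: r1 => /andP[r0 r1].
have r1' : 1 - r != 0 by rewrite gt_eqF//; lra.
have r2' : 1 + r != 0 by rewrite gt_eqF//; lra.
rewrite invf_div; have -> : 1 - r ^+ 2 = (1 - r) * (1 + r) by ring.
by field; rewrite r1' r2'.
Qed.

Lemma is_derive_tanh_half t : is_derive t 1 tanh_half ((1 - tanh_half t ^+ 2)
  / 2).
Proof.
have e0 := expR_gt0 t; have e1 : expR t + 1 != 0 by rewrite gt_eqF//; lra.
apply: is_derive_eq (is_derive_div (x := t) (g := fun s => expR s + 1) e1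
  (is_derive_sub (is_derive_expR t) (is_derive_const 1 t 1))
  (is_derive_add (is_derive_expR t) (is_derive_const 1 t 1))) _.
by rewrite /tanh_half; field.
Qed.

Lemma tanh_half_lt1 t : -1 < tanh_half t < 1.
Proof.
have e0 := expR_gt0 t; rewrite /tanh_half ltr_pdivlMr ?ltr_pdivrMr; lra.
Qed.

Lemma tanh_half_sqr_lt1 t : tanh_half t ^+ 2 < 1.
Proof. by have /andP[] := tanh_half_lt1 t; nra. Qed.

End artanh2_theory.

(** * Geodesics and the exponential map *)

Section geodesics.
Context {R : realType} {N : nat}.
Implicit Types (x u v w : 'rV[R]_N) (c : R -> 'rV[R]_N).

Lemma dotr_delta x i : dotr x (delta_mx 0 i) = x 0 i.
Proof.
rewrite /dotr (bigD1 i)//= mxE !eqxx mulr1 big1 ?addr0// => j ji.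
by rewrite mxE (negbTE ji) andbF mulr0.
Qed.

Lemma partial_hmetric x (i j k : 'I_N) : poincare_ball x ->
  partial i (fun z => hmetric z j k) x =
  (j == k)%:R * (16 * x 0 i / (1 - sqnorm x) ^+ 3).
Proof.
move=> xB; have q0 : 1 - sqnorm x != 0 by rewrite gt_eqF// subr_gt0.
rewrite /partial; set e := delta_mx 0 i.
have dq : is_derive x e (fun z =>
  (1 - sqnorm z) ^+ 2) (2 * (1 - sqnorm x) * (0 - 2 * dotr x e)).
  exact: (is_derive_sqr (is_derive_sub (is_derive_const 1 x e)
    (is_derive_sqnorm (is_derive_id x e)))).
suff : is_derive x e (fun z => hmetric z j k)
    ((j == k)%:R * (16 * x 0 i / (1 - sqnorm x) ^+ 3)) by case.
have -> : (fun z : 'rV[R]_N => hmetric z j k) = (fun z =>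
  (j == k)%:R * (4 / (1 - sqnorm z) ^+ 2)).
  by apply/funext => z; rewrite /hmetric mxE [RHS]mulr_natl.
apply: is_derive_eq (is_derive_mul (is_derive_const (j == k)%:R x e)
  (is_derive_div (x := x) (g := fun z : 'rV[R]_N => (1 - sqnorm z) ^+ 2)
    (expf_neq0 2 q0) (is_derive_const 4 x e) dq)) _.
by rewrite dotr_delta; field.
Qed.

(** For a metric [L delta_ij] the symbols are half of [delta_jk d_i + delta_ik d_j - delta_ij d_k]
    applied to [ln L], and here [d_i ln L = 4 x_i / (1 - |x|^2)]. *)
Lemma christoffelE x (i j k : 'I_N) : poincare_ball x ->
  christoffel k i j x = 2 / (1 - sqnorm x) *
    ((j == k)%:R * x 0 i + (i == k)%:R * x 0 j - (i == j)%:R * x 0 k).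
Proof.
move=> xB; have q0 : 1 - sqnorm x != 0 by rewrite gt_eqF// subr_gt0.
rewrite /christoffel {1}/hmetric invmx_scalar (bigD1 k)//= big1 => [|l lk];
  last first.
  by rewrite mxE eq_sym (negbTE lk) mulr0n mul0r.
rewrite !partial_hmetric// mxE eqxx mulr1n invf_div.  
move: (1 - sqnorm x) q0 (x 0 i) (x 0 j) (x 0 k) => d d0 a b c.
move: ((j == k)%:R : R) ((i == k)%:R : R) ((i == j)%:R : R) => e1 e2 e3.
by field; exact: d0.
Qed.

Lemma christoffel_quadratic x v (k : 'I_N) : poincare_ball x ->
  \sum_i \sum_j christoffel k i j x * v 0 i * v 0 j =
  2 / (1 - sqnorm x) * (2 * dotr x v * v 0 k - sqnorm v * x 0 k).
Proof.
move=> xB.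
transitivity (\sum_i (2 / (1 - sqnorm x)) *
    (x 0 i * v 0 i * v 0 k + (i == k)%:R * (v 0 i * dotr x v) - v 0 i ^+ 2 * x
      0 k)).
  apply: eq_bigr => i _.
  transitivity (\sum_j (2 / (1 - sqnorm x)) *
    ((j == k)%:R * (x 0 i * v 0 i * v 0 j) + (i == k)%:R * v 0 i * (x 0 j * v
      0 j)
     - (j == i)%:R * (v 0 i * v 0 j * x 0 k))).
    apply: eq_bigr => j _; rewrite christoffelE// (eq_sym i j).
    move: (2 / _) (x 0 i) (x 0 j) (x 0 k) (v 0 i) (v 0 j) => d a b c a' b'.
    by move: ((j == k)%:R : R) ((i == k)%:R : R) ((j == i)%:R : R) => *; ring.
  rewrite -mulr_sumr sumrB big_split /=; congr (_ * (_ + _ - _)).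
  - rewrite (bigD1 k)//= eqxx mul1r big1 ?addr0// => j jk.
    by rewrite (negbTE jk) mul0r.
  - by rewrite -mulr_sumr mulrA.
  - rewrite (bigD1 i)//= eqxx mul1r big1 ?addr0 -?expr2// => j ji.
    by rewrite (negbTE ji) mul0r.
rewrite -mulr_sumr sumrB big_split /= -!mulr_suml; congr (_ * (_ - _)).
rewrite -/(dotr x v) (bigD1 k)//= eqxx mul1r big1 ?addr0; first by ring.
by move=> j jk; rewrite (negbTE jk) mul0r.
Qed.

Lemma is_derive_derive1 c t : derivable c t 1 -> is_derive t 1 c (derive1 c t).
Proof. by move=> ct; rewrite derive1E; exact/derivableP. Qed.

(** The geodesic equation in vector form. Naming the velocity and the acceleration as functions lets
    the [is_derive] rules be composed on them. *)
Lemma is_geodesicP c : is_geodesic c <->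
  exists c1 c2 : R -> 'rV[R]_N, [/\ forall t, poincare_ball (c t),
    forall t : R, is_derive t 1 c (c1 t), forall t : R,
      is_derive t 1 c1 (c2 t) &
    forall t, c2 t = (2 / (1 - sqnorm (c t))) *:
      (sqnorm (c1 t) *: c t - (2 * dotr (c t) (c1 t)) *: c1 t)].
Proof.
split=> [gc|[c1 [c2 [cB dc dc1 c2E]]] t].
  exists (derive1 c), (derive1 (derive1 c)); split => t;
    have [cB ct c1t Ht] := gc t.
  - exact: cB.
  - exact: is_derive_derive1.
  - exact: is_derive_derive1.
  - apply/rowP => k; have := Ht k; rewrite christoffel_quadratic// !mxE => H.
    move: (derive1 (derive1 c) t 0 k) H => a.
    move: (2 / (1 - sqnorm (c t))) => m; move: (dotr _ _) (sqnorm _) => d p.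
    move: (derive1 c t 0 k) (c t 0 k) => b e H.
    by apply/eqP; rewrite -subr_eq0 -[X in _ == X]H; apply/eqP; ring.
have c1E : derive1 c = c1.
  by apply/funext => s; rewrite derive1E; have [] := dc s.
have c2E' : derive1 c1 = c2.
  by apply/funext => s; rewrite derive1E; have [] := dc1 s.
rewrite c1E c2E'; split; [exact: cB|by have [] := dc t| |].
- by have [] := dc1 t.
- move=> k; rewrite christoffel_quadratic// c2E !mxE.
  move: (2 / (1 - sqnorm (c t))) => m; move: (dotr _ _) (sqnorm _) => d p.
  move: (c1 t 0 k) (c t 0 k) => b e.
  by ring.
Qed.

Lemma is_derive0_cst (f : R -> R) : (forall t : R, is_derive t 1 f 0) ->
  forall t, f t = f 0.
Proof. by move=> f0 t; exact: is_derive_0_is_cst. Qed.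

Lemma is_derive_exp_cst (y : R -> R) (k : R) :
  (forall t : R, is_derive t 1 y (k * y t)) -> forall t,
    y t = y 0 * expR (k * t).
Proof.
move=> yk t; have : y t * expR (- (k * t)) = y 0.
  have dk (s : R) : is_derive s 1 (fun s => - (k * s)) (- k).
    by apply: is_derive_eq (is_deriveN (is_derive_mul (is_derive_const k s 1)
      (is_derive_id s 1))) _;
      rewrite mul0r add0r mulr1.
  have H : forall s : R, is_derive s 1 (fun s => y s * expR (- (k * s))) 0.
    move=> s; apply: is_derive_eq (is_derive_mul (yk s)
      (is_derive_chain (dk s) (is_derive_expR _))) _; ring.
  by rewrite (is_derive0_cst H) mulr0 oppr0 expR0 mulr1.
by move=> <-; rewrite -mulrA -expRD addNr expR0 mulr1.
Qed.

(** The operator factors: [y' + k y] and [y' - k y] solve first-order equations with rates [k] and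
    [-k], and [y] is their difference over [2 k]. Uniqueness thus reduces to the constancy of a
    function with zero derivative. *)
Lemma second_order_linear (y y1 : R -> R) (k : R) : k != 0 ->
  (forall t : R, is_derive t 1 y (y1 t)) ->
  (forall t : R, is_derive t 1 y1 (k ^+ 2 * y t)) ->
  y 0 = 0 -> forall t, y t = y1 0 / k * sinh (k * t).
Proof.
move=> k0 dy dy1 y0 t.
have dP (s : R) : is_derive s 1 (fun r =>
  y1 r + k * y r) (k * (y1 s + k * y s)).
  by apply: is_derive_eq (is_derive_add (dy1 s)
    (is_derive_mul (is_derive_const k s 1) (dy s))) _; ring.
have dM (s : R) : is_derive s 1 (fun r =>
  y1 r - k * y r) (- k * (y1 s - k * y s)).
  by apply: is_derive_eq (is_derive_sub (dy1 s)
    (is_derive_mul (is_derive_const k s 1) (dy s))) _; ring.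
have := is_derive_exp_cst dP t; rewrite y0 mulr0 addr0 => P.
have := is_derive_exp_cst dM t; rewrite y0 mulr0 subr0 mulNr => M.
have -> : y t = ((y1 t + k * y t) - (y1 t - k * y t)) / (2 * k) by field.
by rewrite P M /sinh; field.
Qed.

End geodesics.

(** * The exponential map at the origin and the radial derivative *)

Section exponential_map.
Context {R : realType} {N : nat}.
Implicit Types (x u v w : 'rV[R]_N) (c : R -> 'rV[R]_N).

Lemma dotrBl x u v : dotr (x - u) v = dotr x v - dotr u v.
Proof. by rewrite /dotr -sumrB; apply: eq_bigr => i _; rewrite !mxE mulrBl. Qed.

Lemma is_geodesic_radial (t : R) w : sqnorm w = 1 ->
  is_geodesic (fun s => tanh_half (t * s) *: w).
Proof.
move=> w1; pose h s := tanh_half (t * s); pose h1 s := t * (1 - h s ^+ 2) / 2.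
have dts (s : R) : is_derive s 1 (fun s => t * s) t.
  by apply: is_derive_eq (is_derive_mul (is_derive_const t s 1) (is_derive_id
    s 1)) _;
    rewrite mul0r add0r mulr1.
have dh (s : R) : is_derive s 1 h (h1 s).
  apply: is_derive_eq (is_derive_chain (dts s) (is_derive_tanh_half _)) _.
  by rewrite /h1 /h; field.
have dh1 (s : R) : is_derive s 1 h1 (- t * h s * h1 s).
  apply: is_derive_eq (is_derive_mul (is_derive_mul (is_derive_const t s 1)
    (is_derive_sub (is_derive_const 1 s 1) (is_derive_sqr (dh s))))
    (is_derive_const 2^-1 s 1)) _.
  by field.
have hlt s : 1 - h s ^+ 2 != 0 by rewrite gt_eqF// subr_gt0 tanh_half_sqr_lt1.
apply/is_geodesicP; exists (fun s => h1 s *: w), (fun s =>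
  (- t * h s * h1 s) *: w).
split => s.
- by rewrite /poincare_ball /= sqnormZ w1 mulr1 tanh_half_sqr_lt1.
- exact: is_derive_scale_line.
- exact: is_derive_scale_line.
- rewrite !sqnormZ dotrZl dotrZr dotr_sqnorm w1 -/(h s) !scalerA -scalerBl
  scalerA.
  congr (_ *: _); rewrite /h1 !mulr1; move: (h s) (hlt s) => a a0.
  by field.
Qed.

(* With m = 2 / (1 - |c|^2), the curve X = m c is the spatial part of the
   geodesic in the hyperboloid model: the energy E = m^2 |c'|^2 is constant and
   X'' = E X, a linear equation. *)
Lemma geodesic_unique (t : R) w c : t != 0 -> sqnorm w = 1 -> is_geodesic c ->
  c 0 = 0 -> derive1 c 0 = (t / 2) *: w -> c 1 = tanh_half t *: w.
Proof.
move=> t0 w1 /is_geodesicP[c1 [c2 [cB dc dc1 c2E]]] c00 c10.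
have {}c10 : c1 0 = (t / 2) *: w.
  by rewrite -c10 derive1E; have [_ ->] := dc 0.
pose q s := sqnorm (c s); pose d s := dotr (c s) (c1 s).
pose p s := sqnorm (c1 s); pose m s := 2 / (1 - q s).
have q1 s : 1 - q s != 0 by rewrite gt_eqF// subr_gt0; exact: cB.
have cc2 s : dotr (c s) (c2 s) = m s * (p s * q s - 2 * d s ^+ 2).
  rewrite c2E dotrZr dotrC dotrBl !dotrZl dotr_sqnorm [dotr (c1 s) _]dotrC.
  by rewrite -/(d s) -/(p s) -/(q s) -/(m s); ring.
have c1c2 s : dotr (c1 s) (c2 s) = - (m s * d s * p s).
  rewrite c2E dotrZr dotrC dotrBl !dotrZl dotr_sqnorm.
  by rewrite -/(d s) -/(p s) -/(q s) -/(m s); ring.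
have dq (s : R) : is_derive s 1 q (2 * d s) by exact: is_derive_sqnorm.
have dd (s : R) : is_derive s 1 d (p s + m s * (p s * q s - 2 * d s ^+ 2)).
  apply: is_derive_eq (is_derive_dotr (dc s) (dc1 s)) _.
  by rewrite dotr_sqnorm cc2.
have dp (s : R) : is_derive s 1 p (- (2 * m s * d s * p s)).
  by apply: is_derive_eq (is_derive_sqnorm (dc1 s)) _; rewrite c1c2; ring.
have dm (s : R) : is_derive s 1 m (m s ^+ 2 * d s).
  apply: is_derive_eq (is_derive_div (x := s) (g := fun s => 1 - q s) (q1 s)
    (is_derive_const 2 s 1) (is_derive_sub (is_derive_const 1 s 1) (dq s))) _.
  by rewrite /m; field.
(* The conserved energy is evaluated at time 0, where [m = 2] and the velocity is [(t/2) w] with [w]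
   a unit vector. *)
have E0 s : m s ^+ 2 * p s = t ^+ 2.
  have dE (r : R) : is_derive r 1 (fun s => m s ^+ 2 * p s) 0.
    apply: is_derive_eq (is_derive_mul (is_derive_sqr (dm r)) (dp r)) _; ring.
  rewrite (is_derive0_cst dE) /m /q /p c00 c10 sqnormZ w1.
  rewrite (_ : sqnorm 0 = 0); last by apply/eqP; rewrite sqnorm_eq0.
  by field.
have X i s : m s * c s 0 i = w 0 i * sinh (t * s).
  pose y1 s := m s ^+ 2 * d s * c s 0 i + m s * c1 s 0 i.
  have dX (r : R) : is_derive r 1 (fun s => m s * c s 0 i) (y1 r).
    have ci := (is_derive_coordP _ _ _ _).1 (dc r) i.
    exact: is_derive_eq (is_derive_mul (dm r) ci) _.
  have dY (r : R) : is_derive r 1 y1 (t ^+ 2 * (m r * c r 0 i)).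
    have ci := (is_derive_coordP _ _ _ _).1 (dc r) i.
    have c1i := (is_derive_coordP _ _ _ _).1 (dc1 r) i.
    apply: is_derive_eq (is_derive_add (is_derive_mul (is_derive_mul
      (is_derive_sqr (dm r)) (dd r)) ci) (is_derive_mul (dm r) c1i)) _.
    rewrite -(E0 r) c2E !mxE -/(q r) -/(p r) -/(d r) -/(m r).
    have mq : m r * q r = m r - 2.
      by rewrite /m; move: (q r) (q1 r) => a a0; field.
    have -> : p r + m r * (p r * q r - 2 * d r ^+ 2) =
       p r + p r * (m r * q r) - 2 * m r * d r ^+ 2.
      by move: (m r) (p r) (q r) (d r) => *; ring.
    rewrite mq; move: (m r) (p r) (d r) (c r 0 i) (c1 r 0 i) => *; ring.
  have X0 : m 0 * c 0 0 i = 0 by rewrite c00 mxE mulr0.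
  have -> := second_order_linear t0 dX dY X0 s.
  rewrite /y1 c00 c10 !mxE mulr0 add0r /m /q c00.
  rewrite (_ : sqnorm 0 = 0); last by apply/eqP; rewrite sqnorm_eq0.
  by congr (_ * _); move: (w 0 i) => a; field.
(* [C] is [cosh t]. The time coordinate in the hyperboloid model is
   [(1 + |c|^2) / (1 - |c|^2) = m - 1]; at time 1 it has the same square as [C], and both are
   positive. The endpoint then follows from [tanh (t/2) = sinh t / (1 + cosh t)]. *)
pose S : R := sinh t; pose C : R := (expR t + expR (- t)) / 2.
have CS : C ^+ 2 = 1 + S ^+ 2.
  have := expRxMexpNx_1 t; rewrite /C /S /sinh; move: (expR t) (expR (- t)) =>
    a b ab.
  have -> : ((a + b) / 2) ^+ 2 = a * b + ((a - b) / 2) ^+ 2 by field.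
  by rewrite ab.
have C0 : 0 < C by rewrite divr_gt0// addr_gt0// expR_gt0.
have qS : m 1 ^+ 2 * q 1 = S ^+ 2.
  have -> : m 1 ^+ 2 * q 1 = \sum_i (m 1 * c 1 0 i) ^+ 2.
    by rewrite -sqnormZ; apply: eq_bigr => i _; rewrite mxE.
  under eq_bigr do rewrite X mulr1 exprMn.
  by rewrite -mulr_suml -/(sqnorm w) w1 mul1r.
have mC : m 1 = 1 + C.
  have q1gt : 0 < 1 - q 1 by rewrite subr_gt0; exact: cB.
  have m1 : 1 < m 1 by rewrite /m ltr_pdivlMr// mul1r;
    have := sqnorm_ge0 (c 1); rewrite -/(q 1); lra.
  have : (m 1 - 1) ^+ 2 = C ^+ 2.
    rewrite CS -qS; have mq : m 1 * q 1 = m 1 - 2 by rewrite /m; field.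
    by rewrite expr2 -mulrA mq; ring.
  move=> /eqP; rewrite eqrXn2 ?subr_ge0 ?ltW// => /eqP <-; ring.
apply/rowP => i; rewrite mxE; apply: (@mulfI _ (m 1)).
  by rewrite mC gt_eqF//; lra.
rewrite X mulr1 mC (_ : sinh t = (1 + C) * tanh_half t); first by ring.
rewrite /tanh_half /sinh /C expRN; have e0 := expR_gt0 t.
by move: (expR t) e0 => a a0; field; rewrite !gt_eqF//; lra.
Qed.

(** At the origin the metric is four times the Euclidean one, so for a Euclidean unit vector [w] it
    is [(t/2) w] that has hyperbolic length [|t|]. The radial curve gives existence and
    [geodesic_unique] the uniqueness that determines the value of [xget]. *)
Lemma hexp0E (t : R) w : t != 0 -> sqnorm w = 1 ->
  hexp 0 ((t / 2) *: w) = tanh_half t *: w.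
Proof.
move=> t0 w1; apply: xget_unique.
  exists (fun s => tanh_half (t * s) *: w); split.
  - exact: is_geodesic_radial.
  - by rewrite mulr0 /tanh_half expR0 subrr mul0r scale0r.
  - rewrite derive1E.
    have dts : is_derive (0 : R) 1 (fun s : R => t * s) t.
      by apply: is_derive_eq (is_derive_mul (is_derive_const t (0 : R) 1)
        (is_derive_id (0 : R) 1)) _;
      rewrite mul0r add0r mulr1.
    have [_ ->] := is_derive_scale_line w (is_derive_chain dts
      (is_derive_tanh_half _)).
    by congr (_ *: _); rewrite mulr0 /tanh_half expR0 subrr mul0r expr0n subr0
      mulrC mul1r.
  - by rewrite mulr1.
by move=> y [c [gc c0 c1 <-]]; exact: geodesic_unique.
Qed.

Lemma hnorm0 v : hnorm 0 v = 2 * Num.sqrt (sqnorm v).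
Proof.
have s0 : sqnorm (0 : 'rV[R]_N) = 0 by apply/eqP; rewrite sqnorm_eq0.
by rewrite hnormE ?s0 ?subr0 ?divr1// /poincare_ball /= s0.
Qed.

Lemma enorm_gt0 x : x != 0 -> 0 < enorm x.
Proof.
by move=> x0; rewrite sqrtr_gt0 lt_neqAle eq_sym sqnorm_eq0 x0 sqnorm_ge0.
Qed.

Lemma rho_gt0 x : poincare_ball x -> x != 0 -> 0 < rho x.
Proof. by move=> xB x0; rewrite rhoE// artanh2_gt0// enorm_gt0// enorm_lt1. Qed.

Lemma hnorm0_eq1 u : hnorm 0 u = 1 -> sqnorm (2 *: u) = 1.
Proof.
rewrite hnorm0 => /(congr1 (fun z => z ^+ 2)).
by rewrite expr1n exprMn sqr_sqrtr ?sqnorm_ge0// sqnormZ.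
Qed.

Lemma radial_dirE x : poincare_ball x -> x != 0 ->
  radial_dir x = (2 * enorm x)^-1 *: x.
Proof.
move=> xB x0; have e0 := enorm_gt0 x0; have e1 := enorm_lt1 xB.
have r0 := rho_gt0 xB x0.
have tr : tanh_half (rho x) = enorm x.
  by rewrite rhoE// artanh2K// e1 andbT (lt_trans _ e0).
have H u : rho x *: u = (rho x / 2) *: (2 *: u).
  by rewrite scalerA divfK.
apply: xget_unique.
  have h1 : hnorm 0 ((2 * enorm x)^-1 *: x) = 1.
    rewrite hnorm0 sqnormZ sqrtrM ?sqr_ge0// sqrtr_sqr ger0_norm ?invr_ge0
      ?mulr_ge0 ?ltW//.
    by rewrite -/(enorm x); field; rewrite gt_eqF.
  split=> //; rewrite H hexp0E ?gt_eqF//; last exact: hnorm0_eq1.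
  rewrite tr !scalerA (_ : _ * _ = 1) ?scale1r//.
  by field; rewrite gt_eqF.
move=> u [/hnorm0_eq1 hu]; rewrite H hexp0E ?gt_eqF// tr => ux.
rewrite -[X in _ *: X]ux !scalerA (_ : _ * _ = 1) ?scale1r//.
by field; rewrite gt_eqF.
Qed.

Lemma sqnorm_normalized x : x != 0 -> sqnorm ((enorm x)^-1 *: x) = 1.
Proof.
by move=> x0; rewrite sqnormZ -enorm_sqr -exprMn mulVf ?expr1n// gt_eqF//
  enorm_gt0.
Qed.

Lemma hexp_radial_dir x (t : R) : poincare_ball x -> x != 0 -> t != 0 ->
  hexp 0 (t *: radial_dir x) = tanh_half t *: ((enorm x)^-1 *: x).
Proof.
move=> xB x0 t0; rewrite -hexp0E ?sqnorm_normalized//; congr hexp.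
rewrite radial_dirE// !scalerA; congr (_ *: _).
by field; rewrite gt_eqF// enorm_gt0.
Qed.

Lemma tanh_half_rho x : poincare_ball x -> x != 0 -> tanh_half (rho x) = enorm
  x.
Proof.
move=> xB x0; rewrite rhoE// artanh2K// enorm_lt1// andbT.
by have := enorm_ge0 x; lra.
Qed.

Lemma rho_tanh_half w (t : R) : sqnorm w = 1 -> 0 < t -> rho (tanh_half t *:
  w) = t.
Proof.
move=> w1 t0; have e0 := expR_gt0 t.
have e1 : 1 < expR t by rewrite expR_gt1.
have th0 : 0 <= tanh_half t by rewrite divr_ge0//; lra.
rewrite rhoE; last by rewrite /poincare_ball /= sqnormZ w1 mulr1
  tanh_half_sqr_lt1.
rewrite /enorm sqnormZ w1 mulr1 sqrtr_sqr ger0_norm// -[RHS]expRK /artanh2;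
  congr ln.
by rewrite /tanh_half; move: (expR t) e0 => a a0; field; rewrite gt_eqF//; lra.
Qed.

Lemma is_derive_radial (f : 'rV[R]_N -> R) x : poincare_ball x -> x != 0 ->
  differentiable f x ->
  is_derive (rho x) 1 (fun t : R => f (hexp 0 (t *: radial_dir x)))
    ((1 - sqnorm x) / (2 * enorm x) * \sum_i x 0 i * partial i f x).
Proof.
move=> xB x0 fx; have e0 := enorm_gt0 x0; have r0 := rho_gt0 xB x0.
pose w := (enorm x)^-1 *: x.
pose c (t : R) := tanh_half t *: w.
have dc : is_derive (rho x) 1 c (((1 - sqnorm x) / 2) *: w).
  apply: is_derive_eq (is_derive_scale_line w (is_derive_tanh_half _)) _.
  by rewrite tanh_half_rho// enorm_sqr.
have cx : c (rho x) = x.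
  by rewrite /c tanh_half_rho// scalerA divff ?scale1r// gt_eqF.
have fc : differentiable f (c (rho x)) by rewrite cx.
have H : is_derive (rho x) 1 (fun t : R => f (hexp 0 (t *: radial_dir x)))
    (\sum_i (((1 - sqnorm x) / 2) *: w) 0 i * partial i f (c (rho x))).
  (* The closed form of [hexp] is available for [t != 0], so the two functions are compared near the
     positive number [rho x]. *)
  apply: near_eq_is_derive (is_derive_comp_curve fc dc).
  have : \forall t \near rho x, 0 < t by exact: lt_nbhsr.
  by apply: filterS => t t0 /=; rewrite hexp_radial_dir// gt_eqF.
apply: is_derive_eq H _; rewrite cx mulr_sumr; apply: eq_bigr => i _;
  rewrite !mxE.
by field; rewrite gt_eqF.
Qed.

Lemma radial_deriveE (f : 'rV[R]_N -> R) x : poincare_ball x -> x != 0 ->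
  differentiable f x ->
  radial_derive f x =
  (1 - sqnorm x) / (2 * enorm x) * \sum_i x 0 i * partial i f x.
Proof.
by move=> xB x0 fx; rewrite /radial_derive derive1E;
  have [_ ->] := is_derive_radial xB x0 fx.
Qed.

End exponential_map.

(** * The ground state *)

Section radial_profile.
Context {R : realType}.
Implicit Types n r s : R.

(* Functions of the hyperbolic distance [artanh2 r] to the origin, written in
   terms of the Euclidean radius [r]. *)
Definition coth_radius r : R := (1 + r ^+ 2) / (2 * r).

Definition log_weight n r : R := (n - 1) / 2 * coth_radius r - (2 * artanh2
  r)^-1.

Definition hardy_potential n r : R :=
  (n - 1) ^+ 2 / 4 + 1 / 4 * (1 / artanh2 r ^+ 2) +
  (n - 1) * (n - 3) / 4 * (1 / (2 * r / (1 - r ^+ 2)) ^+ 2).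

Lemma is_derive_ge0_le (f df : R -> R) r : 0 <= r ->
  (forall s, 0 <= s <= r -> is_derive s 1 f (df s)) ->
  (forall s, 0 <= s <= r -> 0 <= df s) -> f 0 <= f r.
Proof.
move=> r0 fd d0; apply: (@ger0_derive1_ndecr _ f 0 r) => //.
- by move=> s; rewrite in_itv /= => /andP[s0 s1]; have [|] := fd s;
  rewrite ?ltW.
- move=> s; rewrite in_itv /= => /andP[s0 s1].
  have s01 : 0 <= s <= r by rewrite !ltW.
  by rewrite derive1E; have [_ ->] := fd s s01; exact: d0.
- apply: continuous_in_subspaceT => s; rewrite inE /= in_itv /= => s01.
  by apply: differentiable_continuous; apply/derivable1_diffP;
    have [] := fd s s01.
Qed.

(** The difference vanishes at 0 and increases. With [rho = artanh2 r] this is [rho <= sinh rho];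
    the companion bound [tanh rho <= rho] follows in the same way. *)
Lemma artanh2_le_sinh r : 0 <= r < 1 -> artanh2 r <= 2 * r / (1 - r ^+ 2).
Proof.
move=> /andP[r0 r1].
suff : 2 * 0 / (1 - 0 ^+ 2) - artanh2 0 <= 2 * r / (1 - r ^+ 2) - artanh2 r.
  by rewrite artanh2_0 mulr0 mul0r subrr subr_ge0.
apply: (is_derive_ge0_le (f := fun s => 2 * s / (1 - s ^+ 2) - artanh2 s)
  (df := fun s => 4 * s ^+ 2 / (1 - s ^+ 2) ^+ 2)) => //.
- move=> s /andP[s0 sr]; have q0 : 1 - s ^+ 2 != 0 by rewrite gt_eqF//; nra.
  apply: is_derive_eq (is_derive_sub (is_derive_div (x := s) (g := fun s =>
    1 - s ^+ 2) q0
    (is_derive_mul (is_derive_const 2 s 1) (is_derive_id s 1))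
    (is_derive_sub (is_derive_const 1 s 1) (is_derive_sqr (is_derive_id s 1))))
    (is_derive_artanh2 _)) _; first by apply/andP; split; lra.
  by field.
- by move=> s _; rewrite divr_ge0 ?sqr_ge0// mulr_ge0// sqr_ge0.
Qed.

Lemma tanh_le_artanh2 r : 0 <= r < 1 -> 2 * r / (1 + r ^+ 2) <= artanh2 r.
Proof.
move=> /andP[r0 r1].
suff : artanh2 0 - 2 * 0 / (1 + 0 ^+ 2) <= artanh2 r - 2 * r / (1 + r ^+ 2).
  by rewrite artanh2_0 mulr0 mul0r subrr subr_ge0.
apply: (is_derive_ge0_le (f := fun s => artanh2 s - 2 * s / (1 + s ^+ 2))
  (df := fun s => 8 * s ^+ 2 / ((1 - s ^+ 2) * (1 + s ^+ 2) ^+ 2))) => //.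
- move=> s /andP[s0 sr]; have q0 : 1 - s ^+ 2 != 0 by rewrite gt_eqF//; nra.
  have q1 : 1 + s ^+ 2 != 0 by rewrite gt_eqF//; nra.
  apply: is_derive_eq (is_derive_sub (is_derive_artanh2 _)
    (is_derive_div (x := s) (g := fun s => 1 + s ^+ 2) q1
    (is_derive_mul (is_derive_const 2 s 1) (is_derive_id s 1))
    (is_derive_add (is_derive_const 1 s 1) (is_derive_sqr (is_derive_id s
      1))))) _;
    first by apply/andP; split; lra.
  by field; rewrite q1 q0.
- move=> s /andP[s0 sr]; rewrite divr_ge0 ?mulr_ge0 ?sqr_ge0//; nra.
Qed.

(** * Bounds on the radial profiles near the origin *)

Section bounds.
Variable r : R.
Hypothesis r01 : 0 < r < 1.
(** With [rho = artanh2 r], the quantities [K], [P], [Z] are [coth rho], [1/rho] and [1/sinh rho].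
    The estimates rest on [Z <= P <= K], on [K^2 = 1 + Z^2] and on the expressions of [K] and [Z] in
    [r]. *)
Let K := coth_radius r.
Let P := (artanh2 r)^-1.
Let Z := (2 * r / (1 - r ^+ 2))^-1.

Let r0 : 0 < r. Proof. by case/andP: r01. Qed.
Let r1 : r < 1. Proof. by case/andP: r01. Qed.

Let P0 : 0 < P. Proof. by rewrite invr_gt0 artanh2_gt0. Qed.

Let K0 : 0 < K.
Proof. by rewrite divr_gt0 ?mulr_gt0// ltr_wpDr ?sqr_ge0. Qed.

Let PK : P <= K.
Proof.
rewrite -[K]invrK lef_pV2 ?posrE ?artanh2_gt0 ?invr_gt0//.
by rewrite invf_div tanh_le_artanh2// (ltW r0) r1.
Qed.

Let Z0 : 0 < Z.
Proof. by rewrite invr_gt0 divr_gt0 ?mulr_gt0// subr_gt0 exprn_ilt1// ltW. Qed.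

Let ZP : Z <= P.
Proof.
rewrite lef_pV2 ?posrE ?artanh2_gt0//; last by rewrite -invr_gt0.
by rewrite artanh2_le_sinh// (ltW r0) r1.
Qed.

Let KZ : K ^+ 2 = 1 + Z ^+ 2.
Proof. by rewrite /K /Z /coth_radius invf_div; field; rewrite gt_eqF. Qed.

Let K2r : K * (2 * r) = 1 + r ^+ 2.
Proof. by rewrite /K /coth_radius divfK// gt_eqF// mulr_gt0. Qed.

Let Z2r : Z * (2 * r) = 1 - r ^+ 2.
Proof. by rewrite /Z invf_div divfK// gt_eqF// mulr_gt0. Qed.

(** Since [Z <= P], [(K - P)(K + P) <= K^2 - Z^2 = 1], so [K - P <= 1/K]; and [K >= 1/(2 r)]. This
    is the cancellation of the two singularities of [coth rho - 1/rho]. *)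
Let KPr : K - P <= 2 * r.
Proof.
move: P0 K0 PK Z0 ZP KZ K2r r0 r1; move: K P Z =>
  k p z p0 k0 pk z0 zp kz k2r rr0 rr1.
have h : (k - p) * (k + p) <= 1 by nra.
have : (k - p) * k <= 1 by nra.
nra.
Qed.

Let rr : r ^+ 2 <= 1.
Proof. by rewrite exprn_ile1// ltW. Qed.

Let Ki : K <= r^-1.
Proof. by rewrite -[r^-1]mul1r ler_pdivlMr//; have := K2r; have := rr; lra. Qed.

Let Zi : Z <= r^-1.
Proof. by rewrite -[r^-1]mul1r ler_pdivlMr//; have := Z2r; have := sqr_ge0 r;
  lra. Qed.

(** With [e] the dimension minus 2, the singular term is isolated with a coefficient that vanishes
    in the plane. *)
Let logE e : log_weight (e + 2) r = e / 2 * K + (K - P) / 2.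
Proof. by rewrite /log_weight invfM -/K -/P; field. Qed.

Let log_ge0 e : 0 <= e -> 0 <= log_weight (e + 2) r.
Proof.
move=> e0; rewrite logE; apply: addr_ge0; last by rewrite divr_ge0 ?subr_ge0.
by apply: mulr_ge0; [exact: divr_ge0|exact: ltW].
Qed.

Let log_le e : 0 <= e -> log_weight (e + 2) r <= e / 2 * r^-1 + r.
Proof.
move=> e0; rewrite logE lerD// ?ler_wpM2l ?divr_ge0//.
by have := KPr; lra.
Qed.

Lemma log_weight_bound (e : R) : 0 <= e ->
  `|log_weight (e + 2) r| / r <= (e + 2) * (1 + e / r ^+ 2).
Proof.
move=> e0; rewrite ger0_norm ?log_ge0// ler_pdivrMr// (le_trans (log_le e0))//.
have ir : r^-1 * r = 1 by rewrite mulVf// gt_eqF.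
have i0 : 0 < r^-1 by rewrite invr_gt0.
have -> : (e + 2) * (1 + e / r ^+ 2) * r =
    (e + 2) * r + (e + 2) * e * (r^-1 * (r^-1 * r)).
  by rewrite -exprVn; ring.
rewrite ir mulr1; have ei : 0 <= e * r^-1 by rewrite mulr_ge0// ltW.
have er : 0 <= e * r by rewrite mulr_ge0// ltW.
have eei : 0 <= e * (e * r^-1) by rewrite mulr_ge0.
have := r0; lra.
Qed.

Lemma log_weight_sqr_bound (e : R) : 0 <= e ->
  log_weight (e + 2) r ^+ 2 <= (e + 2) ^+ 2 * (1 + e / r ^+ 2).
Proof.
move=> e0; apply: (@le_trans _ _ ((e / 2 * r^-1 + r) ^+ 2)).
  by rewrite ler_sqr ?nnegrE ?log_ge0 ?log_le// addr_ge0 ?mulr_ge0 ?divr_ge0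
    ?invr_ge0// ltW.
have ir : r^-1 * r = 1 by rewrite mulVf// gt_eqF.
have -> : (e / 2 * r^-1 + r) ^+ 2 = e ^+ 2 / 4 * r^-1 ^+ 2 + e * (r^-1 * r) +
  r ^+ 2.
  by move: (r^-1) => i; field.
rewrite ir mulr1 -exprVn.
have j0 : 0 <= r^-1 ^+ 2 by rewrite sqr_ge0.
have := rr.
move: (r^-1 ^+ 2) (r ^+ 2) j0 => j q j0 q1.
have ej : 0 <= e * j by rewrite mulr_ge0.
have eej : 0 <= e * (e * j) by rewrite mulr_ge0.
have eeej : 0 <= e * (e * (e * j)) by rewrite mulr_ge0.
nra.
Qed.

Lemma hardy_potential_bound (e : R) : 0 <= e ->
  `|hardy_potential (e + 2) r| <= (e + 2) ^+ 2 * (1 + e / r ^+ 2).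
Proof.
move=> e0.
(* As [(n-1)(n-3) = e^2 - 1], the term [-Z^2/4] can be paired with [P^2/4]; the pair is bounded
   because [Z^2 <= P^2 <= K^2 = 1 + Z^2]. Only [e^2 Z^2 / 4] stays singular. *)
have -> : hardy_potential (e + 2) r =
    (e + 1) ^+ 2 / 4 + (P ^+ 2 - Z ^+ 2) / 4 + e ^+ 2 / 4 * Z ^+ 2.
  rewrite /hardy_potential !div1r -!exprVn -/P -/Z.
  by move: P Z => p z; field.
have PZ : 0 <= P ^+ 2 - Z ^+ 2 <= 1.
  have h1 : Z ^+ 2 <= P ^+ 2 by rewrite ler_sqr// nnegrE ltW.
  have h2 : P ^+ 2 <= K ^+ 2 by rewrite ler_sqr// nnegrE ltW.
  by have := KZ => h3; apply/andP; split; lra.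
have j0 : 0 <= Z ^+ 2 by rewrite sqr_ge0.
have i0 : 0 <= r^-1 by rewrite invr_ge0 ltW.
have Zj : Z ^+ 2 <= r^-1 ^+ 2 by rewrite ler_sqr// nnegrE ltW.
rewrite -exprVn; move: (P ^+ 2 - Z ^+ 2) (Z ^+ 2) (r^-1 ^+ 2) PZ j0 Zj =>
  y z j /andP[y0 y1] z0 zj.
have ez : 0 <= e ^+ 2 / 4 * z by rewrite mulr_ge0// divr_ge0 ?sqr_ge0.
have e1 : 0 <= (e + 1) ^+ 2 by rewrite sqr_ge0.
rewrite ger0_norm; last by lra.
have ej : 0 <= e * (j - z) by rewrite mulr_ge0// subr_ge0.
have eej : 0 <= e * (e * (j - z)) by rewrite mulr_ge0.
have ej' : 0 <= e * j by rewrite mulr_ge0//; lra.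
have eej' : 0 <= e * (e * j) by rewrite mulr_ge0.
have eeej : 0 <= e * (e * (e * j)) by rewrite mulr_ge0.
nra.
Qed.

End bounds.

(** A Riccati equation for [h]: the factor [2 / (1 - r^2)] is the derivative of [rho] in [r], and
    what it multiplies is the derivative of [h] in [rho]. *)
Lemma is_derive_log_weight n r : 0 < r < 1 ->
  is_derive r 1 (log_weight n)
    (2 / (1 - r ^+ 2) * (hardy_potential n r + log_weight n r ^+ 2 -
                         (n - 1) * coth_radius r * log_weight n r)).
Proof.
move=> r01; have P0 := artanh2_gt0 r01; have /andP[r0 r1] := r01.
have q0 : 1 - r ^+ 2 != 0 by rewrite gt_eqF//; nra.
have r20 : 2 * r != 0 by rewrite gt_eqF// mulr_gt0.
have P20 : 2 * artanh2 r != 0 by rewrite gt_eqF// mulr_gt0.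
have dP : is_derive r 1 artanh2 (2 / (1 - r ^+ 2)).
  by apply: is_derive_artanh2; apply/andP; split; lra.
apply: is_derive_eq (is_derive_sub (is_derive_mul (is_derive_const ((n - 1) /
  2) r 1)
   (is_derive_div (x := r) (g := fun s => 2 * s) r20
    (is_derive_add (is_derive_const 1 r 1) (is_derive_sqr (is_derive_id r 1)))
    (is_derive_mul (is_derive_const 2 r 1) (is_derive_id r 1))))
  (is_derive_inv (f := fun s =>
    2 * artanh2 s) P20 (is_derive_mul (is_derive_const 2 r 1) dP))) _.
rewrite /hardy_potential /log_weight /coth_radius.
move: (artanh2 r) P0 => P P0.
by field; rewrite q0 !gt_eqF.
Qed.

End radial_profile.

(** * Multiplication by the ground state *)

Section ground_state.
Context {R : realType} {N : nat}.
Implicit Types (x v : 'rV[R]_N) (f : 'rV[R]_N -> R).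
Local Notation n := (N%:R : R).

Lemma enorm_in01 x : poincare_ball x -> x != 0 -> 0 < enorm x < 1.
Proof. by move=> xB x0; rewrite enorm_gt0//= enorm_lt1. Qed.

Lemma is_derive_enorm x v : x != 0 ->
  is_derive x v (@enorm R N) (dotr x v / enorm x).
Proof.
move=> x0; have q0 : 0 < sqnorm x by rewrite -sqrtr_gt0; exact: enorm_gt0.
apply: is_derive_eq (is_derive_chain (is_derive_sqnorm (is_derive_id x v))
  (is_derive1_sqrt q0)) _.
by rewrite -/(enorm x); field; rewrite gt_eqF// enorm_gt0.
Qed.

Lemma near_poincare_ball x : poincare_ball x -> \forall z \near x,
  poincare_ball z.
Proof. by move=> xB; apply: open_nbhs_nbhs; split=> //;
  exact: open_poincare_ball. Qed.

Lemma is_derive_rho x v : poincare_ball x -> x != 0 ->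
  is_derive x v (@rho R N) (2 / (1 - sqnorm x) / enorm x * dotr x v).
Proof.
move=> xB x0; have /andP[r0 r1] := enorm_in01 xB x0.
apply: (near_eq_is_derive (f := fun z => artanh2 (enorm z))).
  by apply: filterS (near_poincare_ball xB) => z zB; rewrite rhoE.
apply: is_derive_eq (is_derive_chain (is_derive_enorm v x0) (is_derive_artanh2
  _)) _.
  by rewrite r1 andbT; lra.
by rewrite enorm_sqr; field; rewrite !gt_eqF// subr_gt0.
Qed.

Definition ground_weight (a t : R) : R := sinh t `^ a / t `^ (1 / 2).

Lemma sinh_gt0 (t : R) : 0 < t -> 0 < sinh t.
Proof.
by move=> t0; rewrite divr_gt0// subr_gt0 ltr_expR; lra.
Qed.

Lemma is_derive_sinh (t : R) : is_derive t 1 sinh ((expR t + expR (- t)) / 2).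
Proof.
have dN : is_derive t 1 (fun s : R => - s) (- 1) by exact: is_deriveN.
apply: is_derive_eq (is_derive_mul (is_derive_sub (is_derive_expR t)
  (is_derive_chain dN (is_derive_expR (- t)))) (is_derive_const 2^-1 t 1)) _.
by field.
Qed.

Lemma is_derive_ground_weight (a t : R) : 0 < t -> is_derive t 1
  (ground_weight a)
  (ground_weight a t * (a * ((expR t + expR (- t)) / 2 / sinh t) - (2 * t)^-1)).
Proof.
move=> t0; have s0 := sinh_gt0 t0.
have p0 : t `^ (1 / 2) != 0 by rewrite gt_eqF// powR_gt0.
have E (b c : R) : 0 < b -> b `^ (c - 1) = b `^ c / b.
  move=> b0; rewrite powRB ?powRr1 ?ltW//.
  by apply/implyP => _; rewrite gt_eqF.
apply: is_derive_eq (is_derive_div (x := t) (g := fun s => s `^ (1 / 2)) p0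
  (is_derive_chain (is_derive_sinh t) (is_derive1_powR a s0))
  (is_derive1_powR (1 / 2) t0)) _.
rewrite !E// /ground_weight;
  move: (sinh t) (sinh t `^ a) (t `^ (1 / 2)) s0 p0 => s A B s0 p0.
by field; rewrite p0 !gt_eqF.
Qed.

Lemma coth_artanh2 (r : R) : 0 < r < 1 ->
  (expR (artanh2 r) + expR (- artanh2 r)) / 2 / sinh (artanh2 r) = coth_radius
    r.
Proof.
move=> /andP[r0 r1]; have r01 : -1 < r < 1 by apply/andP; split; lra.
rewrite sinh_artanh2// expRN expR_artanh2// /coth_radius invf_div.
have h1 : 1 - r != 0 by rewrite gt_eqF// subr_gt0.
have h2 : 1 + r != 0 by rewrite gt_eqF// addr_gt0.
have -> : 1 - r ^+ 2 = (1 - r) * (1 + r) by ring.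
by field; rewrite h1 h2 gt_eqF.
Qed.

(** The weight of the remainder integral is the inverse square of the ground state, so it cancels
    the factor left by expanding the square. *)
Lemma ground_weight_sqr (t : R) : (0 < N)%N -> 0 < t ->
  t / sinh t ^+ N.-1 * ground_weight ((n - 1) / 2) t ^+ 2 = 1.
Proof.
move=> N0 t0; have s0 := sinh_gt0 t0.
have half (b c : R) : 0 < b -> (b `^ (c / 2)) ^+ 2 = b `^ c.
  move=> b0; rewrite expr2 -powRD; last by apply/implyP => _; rewrite gt_eqF.
  by congr (_ `^ _); field.
rewrite /ground_weight (expr_div_n (sinh t `^ _)) !half// powRr1 ?ltW//.
have -> : n - 1 = N.-1%:R by rewrite -{1}(prednK N0) -natr1 addrK.
rewrite powR_mulrn ?ltW//.
by field; rewrite expf_neq0 ?gt_eqF.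
Qed.

Section fixed.
Variables (f : 'rV[R]_N -> R) (x : 'rV[R]_N).
Hypotheses (N0 : (0 < N)%N) (xB : poincare_ball x) (x0 : x != 0)
  (fx : differentiable f x).
Let r := enorm x.
Let h := log_weight n r.
Let H := ground_weight ((n - 1) / 2) (rho x).
Let Tf := \sum_i x 0 i * partial i f x.

Definition ground_quotient (y : 'rV[R]_N) : R :=
  sinh (rho y) `^ ((n - 1) / 2) * f y / rho y `^ (1 / 2).

Let r01 : 0 < r < 1 := enorm_in01 xB x0.
Let r0 : 0 < r. Proof. by case/andP: r01. Qed.
Let r_neq0 : r != 0. Proof. by rewrite gt_eqF. Qed.
Let q0 : 1 - sqnorm x != 0. Proof. by rewrite gt_eqF// subr_gt0. Qed.

Let dH : is_derive (rho x) 1 (ground_weight ((n - 1) / 2)) (H * h).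
Proof.
apply: is_derive_eq (is_derive_ground_weight _ (rho_gt0 xB x0)) _.
by rewrite -/H rhoE// coth_artanh2.
Qed.

Lemma partial_ground_quotient i : partial i ground_quotient x =
  H * (partial i f x + f x * h * (2 / (1 - sqnorm x) / r) * x 0 i).
Proof.
have df : is_derive x (delta_mx 0 i) f (partial i f x).
  exact/derivableP/diff_derivable.
have E : ground_quotient = fun z => ground_weight ((n - 1) / 2) (rho z) * f z.
  by apply/funext => z; rewrite /ground_weight /ground_quotient mulrAC.
have := is_derive_mul (is_derive_chain (is_derive_rho (delta_mx 0 i) xB x0)
  dH) df.
rewrite -E /partial => -[_ ->]; rewrite dotr_delta -/H -/r;
  move: ('D_ _ f x) => d.
by field; rewrite r_neq0 q0.
Qed.

(** The gradient of the ground weight is radial, so the cross term sees only the radial derivative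
    of [f], which is [(1 - |x|^2) / (2 r) * Tf]. *)
Lemma hgrad_ground_quotient :
  rho x / sinh (rho x) ^+ N.-1 * hnorm x (hgrad ground_quotient x) ^+ 2 =
  hnorm x (hgrad f x) ^+ 2 +
  2 * f x * h * ((1 - sqnorm x) / (2 * r) * Tf) + f x ^+ 2 * h ^+ 2.
Proof.
rewrite !hnorm_hgrad_sqr//.
pose k := f x * h * (2 / (1 - sqnorm x) / r).
have -> : \sum_i partial i ground_quotient x ^+ 2 =
    H ^+ 2 * (\sum_i partial i f x ^+ 2 + 2 * k * Tf + k ^+ 2 * sqnorm x).
  rewrite /Tf /sqnorm !mulr_sumr -!big_split mulr_sumr; apply: eq_bigr => i _.
  rewrite partial_ground_quotient -/k; move: (partial i f x) (x 0 i) => d y.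
  by rewrite /=; ring.
have := ground_weight_sqr N0 (rho_gt0 xB x0); rewrite -/H.
move: (rho x / _) (H ^+ 2) => w H2 wH.
have E (A B : R) : w * (A * (H2 * B)) = A * B
  by rewrite mulrCA (mulrA w) wH mul1r.
rewrite E.
have q0' : 1 - r ^+ 2 != 0 by rewrite enorm_sqr.
rewrite /k -enorm_sqr -/r; move: (\sum_i _) => D.
by move: h (f x) Tf => h' f' T; field; rewrite r_neq0.
Qed.

Lemma radial_derive_ground_quotient :
  radial_derive ground_quotient x = H * (h * f x + radial_derive f x).
Proof.
have p0 := rho_gt0 xB x0; have df := is_derive_radial xB x0 fx.
have D := is_derive_mul dH df.
rewrite /radial_derive derive1E.
suff : is_derive (rho x) 1 (fun t : R =>
  ground_quotient (hexp 0 (t *: radial_dir x)))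
    (H * (h * f x + radial_derive f x)).
  by case=> _ ->.
(* Along the ray the distance to the origin is the parameter [t] as long as [t > 0], so near [rho x]
   the function is a product of two functions of [t]. *)
apply: (near_eq_is_derive (f := fun t => ground_weight ((n - 1) / 2) t *
    f (hexp 0 (t *: radial_dir x)))).
  have : \forall t \near rho x, 0 < t by exact: lt_nbhsr.
  apply: filterS => t t0 /=.
  rewrite /ground_weight /ground_quotient hexp_radial_dir ?gt_eqF//.
  by rewrite rho_tanh_half ?sqnorm_normalized// mulrAC.
apply: is_derive_eq D _; rewrite -radial_deriveE// hexp_radial_dir ?gt_eqF//.
rewrite tanh_half_rho// scalerA divff ?r_neq0// scale1r.
by rewrite -/H; ring.
Qed.

Lemma radial_ground_quotient :
  rho x / sinh (rho x) ^+ N.-1 * radial_derive ground_quotient x ^+ 2 =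
  radial_derive f x ^+ 2 +
  2 * f x * h * ((1 - sqnorm x) / (2 * r) * Tf) + f x ^+ 2 * h ^+ 2.
Proof.
have := ground_weight_sqr N0 (rho_gt0 xB x0); rewrite -/H => wH.
rewrite radial_derive_ground_quotient [in LHS](exprMn 2 H) mulrA wH.
by rewrite mul1r -radial_deriveE//; ring.
Qed.

End fixed.
End ground_state.

(** * Integrability on the punctured ball *)

Section punctured_ball.
Context {R : realType} {N : nat}.
Implicit Types (x : 'rV[R]_N) (F G : 'rV[R]_N -> R).
Local Notation mu := (@lebesgue_tuple R N).

Definition punctured_ball : set 'rV[R]_N := [set x | poincare_ball x /\ x != 0].

Lemma open_punctured_ball : open punctured_ball.
Proof.
have o0 : open (~` [set 0 : 'rV[R]_N]).
  apply: closed_openC; apply: accessible_closed_set1.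
  exact/hausdorff_accessible/norm_hausdorff.
rewrite (_ : punctured_ball = poincare_ball `&` ~` [set 0]).
  by apply: openI => //; exact: open_poincare_ball.
by apply/seteqP; split => x [xB /eqP x0].
Qed.

Let ball_t := [set t : N.-tuple R | poincare_ball (row_of t)].
Let Ot := [set t : N.-tuple R | punctured_ball (row_of t)].

Let mball : measurable ball_t.
Proof. exact: (measurable_row_of_open open_poincare_ball). Qed.

Lemma measurable_punctured_ball : measurable Ot.
Proof. exact: (measurable_row_of_open open_punctured_ball). Qed.

Let mO := measurable_punctured_ball.

Let Z := [set t : N.-tuple R | row_of t = 0].

Let ZE : Z = [set [tuple of nseq N 0]].
Proof.
apply/seteqP; split => t /=.
  move=> /rowP t0; apply/eq_from_tnth => i; have := t0 i.
  by rewrite !mxE => ->; rewrite tnth_nseq.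
by move=> ->; apply/rowP => i; rewrite !mxE tnth_nseq.
Qed.

Let mZ : measurable Z.
Proof.
rewrite (_ : Z = [set t : N.-tuple R | forall i, [set 0] (tnth t i)]).
  exact: measurable_all_tnth.
apply/seteqP; split => t /=.
  by move=> /rowP t0 i; have := t0 i; rewrite !mxE.
by move=> t0; apply/rowP => i; rewrite !mxE.
Qed.

Let ball_tE : ball_t = Ot `|` Z.
Proof.
apply/seteqP; split => t /=.
  by move=> tB; have [t0|t0] := eqVneq (row_of t) 0; [right|left].
case=> [[tB _] //|t0]; rewrite /ball_t /= t0 /poincare_ball /= /sqnorm big1//
  => i _.
by rewrite mxE expr0n.
Qed.

Let ball_tDZ : ball_t `\` Z = Ot.
Proof.
rewrite ball_tE; apply/seteqP; split => t /=; first by case=> [[]].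
by case=> tB t0; split; [left|exact/eqP].
Qed.

Hypothesis N0 : (0 < N)%N.

(** In dimension 0 the measure is a Dirac mass at the origin; a positive dimension makes that point
    negligible. *)
Let muZ : mu Z = 0%E.
Proof. by case: N N0 @Z => // k _; exact: lebesgue_tuple0. Qed.

Lemma integrable_ball (F : N.-tuple R -> \bar R) : mu.-integrable Ot F ->
  mu.-integrable ball_t F /\ (\int[mu]_(t in ball_t) F t = \int[mu]_(t in Ot)
    F t)%E.
Proof.
move=> /integrableP[mF iF].
have mF' : measurable_fun ball_t F.
  rewrite ball_tE; apply/measurable_funU => //; split => //.
  by rewrite ZE; exact: measurable_fun_set1.
have i : mu.-integrable ball_t F.
  apply/integrableP; split => //.
  rewrite (ge0_negligible_integral mZ)// ?ball_tDZ//.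
  exact: measurableT_comp.
by split=> //; rewrite (negligible_integral mZ)// ball_tDZ.
Qed.

(** Passage to a density [G] with respect to Lebesgue measure, to be identified off the origin
    alone, so that conventional values there do not matter. *)
Lemma hintegralE F G :
  (forall x, punctured_ball x -> F x * (2 / (1 - sqnorm x)) ^+ N = G x) ->
  mu.-integrable Ot (EFin \o G \o @row_of R N) ->
  (mu.-integrable ball_t
     (fun t => (F (row_of t) * Num.sqrt (\det (hmetric (row_of t))))%:E)) /\
  (hintegral F = \int[mu]_(t in Ot) (G (row_of t))%:E)%E.
Proof.
move=> FG iG.
have E : {in Ot, EFin \o G \o @row_of R N =1
    (fun t => (F (row_of t) * Num.sqrt (\det (hmetric (row_of t))))%:E)}.
  move=> t; rewrite inE => Ot_t; rewrite /= -FG//; case: Ot_t => tB _.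
  by rewrite sqrt_det_hmetric.
have iF := eq_integrable mO _ _ E iG.
have [iF' FE] := integrable_ball iF; split => //.
by rewrite /hintegral FE; apply/esym/eq_integral => t Ot_t; rewrite -E.
Qed.

(** The coefficient [N.-2] removes [|x|^-2] in the plane, where it is not integrable: the hypothesis
    is then boundedness. *)
Lemma integrable_punctured_ball F (C : R) : 0 <= C ->
  {in punctured_ball, continuous F} ->
  (forall x, punctured_ball x -> `|F x| <= C * (1 + N.-2%:R / sqnorm x)) ->
  mu.-integrable Ot (EFin \o F \o @row_of R N).
Proof.
move=> C0 cF FC.
have iB : mu.-integrable Ot (fun t =>
  (C * (1 + N.-2%:R / sqnorm (row_of t)))%:E).
  apply: (@integrableS _ _ _ _ ball_t) => //; first by move=> t [].
  under eq_fun do rewrite EFinM EFinD.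
  apply: integrableZl => //; apply: integrableD => //.
    apply/integrableP; split; first exact: measurable_cst.
    rewrite integral_cst//= normr1 mul1e; exact: sqnorm_lt_finite.
  exact: integrable_inv_sqnorm.
apply: le_integrable iB => //.
  apply/measurable_EFinP; exact: (measurable_fun_row_of open_punctured_ball).
by move=> t Ot_t /=; rewrite lee_fin (le_trans (FC _ Ot_t))// ler_norm.
Qed.

End punctured_ball.

(** * Continuity at a point *)

Section continuous_at.
Context {R : realType} {T : topologicalType}.
Implicit Types (F G : T -> R) (t : T).

Lemma cont_cst (c : R) t : {for t, continuous (fun=> c : R)}.
Proof. exact: cvg_cst. Qed.

Lemma cont_mul F G t : {for t, continuous F} -> {for t, continuous G} ->
  {for t, continuous (fun s => F s * G s)}.
Proof. by move=> cF cG; exact: cvgM. Qed.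

Lemma cont_add F G t : {for t, continuous F} -> {for t, continuous G} ->
  {for t, continuous (fun s => F s + G s)}.
Proof. by move=> cF cG; exact: cvgD. Qed.

Lemma cont_sub F G t : {for t, continuous F} -> {for t, continuous G} ->
  {for t, continuous (fun s => F s - G s)}.
Proof. by move=> cF cG; exact: cvgB. Qed.

Lemma cont_inv F t : F t != 0 -> {for t, continuous F} ->
  {for t, continuous (fun s => (F s)^-1)}.
Proof. by move=> F0 cF; exact: cvgV. Qed.

Lemma cont_pow F k t : {for t, continuous F} -> {for t, continuous (fun s =>
  F s ^+ k)}.
Proof. by move=> cF; exact: (cvg_comp _ _ cF (@exprn_continuous _ k _)). Qed.

Lemma cont_comp F (g : R -> R) t : {for t, continuous F} ->
  {for F t, continuous g} -> {for t, continuous (fun s => g (F s))}.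
Proof. by move=> cF cg; exact: (cvg_comp _ _ cF cg). Qed.

Lemma cont_sum n (F : 'I_n -> T -> R) t : (forall i, {for t,
  continuous (F i)}) ->
  {for t, continuous (fun s => \sum_i F i s)}.
Proof.
move=> cF; apply: (cvg_big (op := +%R)); last by move=> i _; exact: cF.
by move=> z; apply: cvgD; [exact: cvg_fst|exact: cvg_snd].
Qed.

End continuous_at.

Section radial_continuity.
Context {R : realType}.
Implicit Types r n : R.

Lemma continuous_log_weight n r : 0 < r < 1 -> {for r,
  continuous (log_weight n)}.
Proof.
move=> r01; apply: differentiable_continuous; apply/derivable1_diffP.
by have [] := is_derive_log_weight n r01.
Qed.

Lemma continuous_hardy_potential n r : 0 < r < 1 ->
  {for r, continuous (hardy_potential n)}.
Proof.
move=> r01; have /andP[r0 r1] := r01.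
have cP : {for r, continuous (@artanh2 R)}.
  apply: differentiable_continuous; apply/derivable1_diffP.
  by have [|] := @is_derive_artanh2 R r; rewrite ?r1 ?andbT//; lra.
have q0 : 1 - r ^+ 2 != 0 by rewrite gt_eqF// subr_gt0 exprn_ilt1// ltW.
have cV (g : R -> R) : {for r, continuous g} -> g r != 0 ->
    {for r, continuous (fun s => 1 / g s ^+ 2)}.
  move=> cg g0; apply: cont_mul; first exact: cont_cst.
  apply: cont_inv; first by rewrite expf_neq0.
  exact: cont_pow.
apply: cont_add.
  apply: cont_add; first exact: cont_cst.
  apply: cont_mul; first exact: cont_cst.
  by apply: cV => //; rewrite gt_eqF// artanh2_gt0.
apply: cont_mul; first exact: cont_cst.
apply: cV; last by rewrite mulf_neq0 ?invr_eq0// gt_eqF// mulr_gt0.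
apply: cont_mul; first by apply: cont_mul; [exact: cont_cst|exact: cvg_id].
apply: cont_inv => //; apply: cont_sub; first exact: cont_cst.
exact: exprn_continuous.
Qed.

End radial_continuity.

(** * Densities attached to a compactly supported function *)

Section compact_support.
Context {R : realType} {N : nat}.
Variables (f : 'rV[R]_N -> R) (K : set 'rV[R]_N).
Hypotheses (N2 : (2 <= N)%N) (f_smooth : hsmooth f) (cK : compact K)
  (KB : K `<=` poincare_ball)
  (fK : forall x, poincare_ball x -> ~ K x -> f x = 0).
Implicit Types x y : 'rV[R]_N.
Local Notation n := (N%:R : R).
Local Notation mu := (@lebesgue_tuple R N).
Local Notation Ot := [set t : N.-tuple R | punctured_ball (row_of t)].

Definition euler x : R := \sum_i x 0 i * partial i f x.
Definition grad_sqr x : R := \sum_i partial i f x ^+ 2.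
(** The square root of the conformal factor of the metric; its [N]-th power is the volume
    density. *)
Definition conformal x : R := 2 / (1 - sqnorm x).
(** Off the origin this is the hyperbolic radial derivative of [f], by [radial_deriveE]. *)
Definition radial_part x : R := (1 - sqnorm x) / (2 * enorm x) * euler x.

Lemma hsmooth_differentiable x : poincare_ball x -> differentiable f x.
Proof. exact: (f_smooth [::]). Qed.

Lemma hsmooth_partial i x : poincare_ball x -> differentiable (partial i f) x.
Proof. exact: (f_smooth [:: i]). Qed.

Lemma open_setC_compact : open (~` K).
Proof.
by apply: closed_openC; apply: compact_closed => //; exact: norm_hausdorff.
Qed.

Lemma near_zero_off_support x : poincare_ball x -> ~ K x ->
  \forall y \near x, f y = 0.
Proof.
move=> xB xK; have := near_poincare_ball xB.
have : \forall y \near x, ~ K y.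
  by apply: open_nbhs_nbhs; split => //; exact: open_setC_compact.
by apply: filterS2 => y yK yB; exact: fK.
Qed.

Lemma partial_off_support i x : poincare_ball x -> ~ K x -> partial i f x = 0.
Proof.
move=> xB xK; rewrite /partial -(@derive_cst R _ _ (0 : R) x (delta_mx 0 i)).
by apply: near_eq_derive; exact: near_zero_off_support.
Qed.

Lemma euler_off_support x : poincare_ball x -> ~ K x -> euler x = 0.
Proof.
by move=> xB xK; rewrite /euler big1// => i _;
  rewrite partial_off_support// mulr0.
Qed.

Lemma grad_sqr_off_support x : poincare_ball x -> ~ K x -> grad_sqr x = 0.
Proof.
by move=> xB xK; rewrite /grad_sqr big1// => i _;
  rewrite partial_off_support// expr0n.
Qed.

Lemma continuous_f x : poincare_ball x -> {for x, continuous f}.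
Proof. by move=> xB; apply: differentiable_continuous;
  exact: hsmooth_differentiable. Qed.

Lemma continuous_partial i x : poincare_ball x -> {for x,
  continuous (partial i f)}.
Proof. by move=> xB; apply: differentiable_continuous; exact: hsmooth_partial.
  Qed.

Lemma continuous_euler x : poincare_ball x -> {for x, continuous euler}.
Proof.
move=> xB; apply: cont_sum => i; apply: cont_mul;
  last exact: continuous_partial.
exact: (differentiable_continuous (differentiable_coord x 0 i)).
Qed.

Lemma continuous_grad_sqr x : poincare_ball x -> {for x, continuous grad_sqr}.
Proof.
move=> xB; apply: cont_sum => i.
by apply: cont_pow; exact: continuous_partial.
Qed.

Lemma continuous_conformal x : poincare_ball x -> {for x, continuous conformal}.
Proof.
move=> xB; apply: cont_mul; first exact: cont_cst.
apply: cont_inv; first by rewrite gt_eqF// subr_gt0.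
by apply: cont_sub; [exact: cont_cst|exact: continuous_sqnorm].
Qed.

Lemma continuous_enorm x : {for x, continuous (@enorm R N)}.
Proof. exact: (cvg_comp _ _ (@continuous_sqnorm _ _ x) (@sqrt_continuous R
  _)). Qed.

Lemma continuous_radial_part x : punctured_ball x -> {for x,
  continuous radial_part}.
Proof.
move=> [xB x0]; apply: cont_mul; last exact: continuous_euler.
apply: cont_mul; first by apply: cont_sub;
  [exact: cont_cst|exact: continuous_sqnorm].
apply: cont_inv; first by rewrite mulf_neq0// gt_eqF// enorm_gt0.
by apply: cont_mul; [exact: cont_cst|exact: continuous_enorm].
Qed.

Lemma compact_bounded_fun (F : 'rV[R]_N -> R) :
  (forall x, K x -> {for x, continuous F}) -> exists M, forall x,
    K x -> F x <= M.
Proof.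
move=> cF; have [[x0 Kx0]|/nonemptyPn K0] := pselect (K !=set0); last first.
  by exists 0 => x; rewrite K0.
have [||c _ cmax] := @compact_EVT_max _ _ F K _ cK; first by exists x0.
  by apply: continuous_in_subspaceT => x; rewrite inE; exact: cF.
by exists (F c) => x Kx; apply: cmax; rewrite inE.
Qed.

Lemma support_bound : exists2 M : R, 1 <= M &
  forall x, K x -> [/\ f x ^+ 2 <= M, grad_sqr x <= M & conformal x <= M].
Proof.
have [M1 HM1] : exists M, forall x, K x -> f x ^+ 2 <= M.
  apply: compact_bounded_fun => x /KB xB.
  by apply: cont_pow; exact: continuous_f.
have [M2 HM2] : exists M, forall x, K x -> grad_sqr x <= M.
  by apply: compact_bounded_fun => x /KB xB; exact: continuous_grad_sqr.
have [M3 HM3] : exists M, forall x, K x -> conformal x <= M.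
  by apply: compact_bounded_fun => x /KB xB; exact: continuous_conformal.
exists (1 + `|M1| + `|M2| + `|M3|).
  by rewrite -!addrA lerDl !addr_ge0.
move=> x Kx; have := (HM1 _ Kx, HM2 _ Kx, HM3 _ Kx) => -[[h1 h2] h3].
have := (ler_norm M1, ler_norm M2, ler_norm M3) => -[[g1 g2] g3].
have := (normr_ge0 M1, normr_ge0 M2, normr_ge0 M3) => -[[k1 k2] k3].
by split; lra.
Qed.

Lemma radial_part_sqr_le x : punctured_ball x ->
  radial_part x ^+ 2 <= (1 - sqnorm x) ^+ 2 / 4 * grad_sqr x.
Proof.
move=> [xB x0]; have e0 := enorm_gt0 x0.
have CS : euler x ^+ 2 <= enorm x ^+ 2 * grad_sqr x.
  rewrite enorm_sqr; have := sqr_dotr_le x (\row_i partial i f x).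
  rewrite (_ : dotr _ _ = euler x); last by apply: eq_bigr => i _; rewrite mxE.
  rewrite (_ : sqnorm (\row_i _) = grad_sqr x)//.
  by apply: eq_bigr => i _; rewrite mxE.
have -> : radial_part x ^+ 2 =
    (1 - sqnorm x) ^+ 2 / 4 * (euler x ^+ 2 / enorm x ^+ 2).
  by rewrite /radial_part; field; rewrite gt_eqF.
by rewrite ler_wpM2l ?divr_ge0 ?sqr_ge0// ler_pdivrMr ?exprn_gt0// mulrC.
Qed.

Lemma grad_sqr_ge0 x : 0 <= grad_sqr x.
Proof. by apply: sumr_ge0 => i _; exact: sqr_ge0. Qed.

Lemma radial_part_sqr_le_grad x : punctured_ball x ->
  radial_part x ^+ 2 <= grad_sqr x.
Proof.
move=> Ox; apply: le_trans (radial_part_sqr_le Ox) _.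
rewrite ler_piMl ?grad_sqr_ge0//; case: Ox => xB _.
have q0 := sqnorm_ge0 x; have q1 : sqnorm x < 1 := xB; nra.
Qed.

(* Densities with respect to Lebesgue measure: the volume factor
   [conformal x ^+ N] is included. [radial_div] is the Euclidean divergence of
   the field [radial_field x *: x],
     which is f^2 h d_rho times the volume factor,
   h being the logarithmic derivative in rho of the ground weight. *)
Definition hardy_density x : R :=
  conformal x ^+ N * (hardy_potential n (enorm x) * f x ^+ 2).
Definition grad_density x : R :=
  conformal x ^+ N * ((1 - sqnorm x) ^+ 2 / 4 * grad_sqr x).
Definition radial_density x : R := conformal x ^+ N * radial_part x ^+ 2.
Definition radial_field x : R :=
  f x ^+ 2 * (log_weight n (enorm x) / enorm x) * conformal x ^+ N.-1.
Definition radial_div x : R := conformal x ^+ N *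
  (2 * f x * log_weight n (enorm x) * radial_part x +
   f x ^+ 2 * (log_weight n (enorm x) ^+ 2 + hardy_potential n (enorm x))).

(** Here [M] bounds the quantities depending on [f] and the conformal factor on the support, while
    [b] stands for [1 + (N-2)/|x|^2]. Each density is thereby reduced to a pointwise estimate linear
    in [b]. *)
Let integrable_supported (F : 'rV[R]_N -> R) (C : R -> R) :
  (forall M, 1 <= M -> 0 <= C M) ->
  (forall x, punctured_ball x -> {for x, continuous F}) ->
  (forall x, punctured_ball x -> ~ K x -> F x = 0) ->
  (forall (M b : R) x, punctured_ball x -> 1 <= M -> 1 <= b ->
    f x ^+ 2 <= M -> radial_part x ^+ 2 <= grad_sqr x -> grad_sqr x <= M ->
    0 < conformal x <= M ->
    `|log_weight n (enorm x)| / enorm x <= n * b ->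
    log_weight n (enorm x) ^+ 2 <= n ^+ 2 * b ->
    `|hardy_potential n (enorm x)| <= n ^+ 2 * b -> `|F x| <= C M * b) ->
  mu.-integrable Ot (EFin \o F \o @row_of R N).
Proof.
move=> C0 cF FK FC; have [M M1 HM] := support_bound.
have n2 : N.-2%:R + 2 = n.
  by rewrite -natrD; congr (_%:R); rewrite addn2; case: N N2 => [|[]].
apply: (integrable_punctured_ball (C := C M)) => //.
- exact: C0.
- by move=> x; rewrite inE; exact: cF.
- move=> x Ox; have [xB x0] := Ox; have e01 := enorm_in01 xB x0.
  have b1 : 1 <= 1 + N.-2%:R / sqnorm x.
    by rewrite lerDl divr_ge0// sqnorm_ge0.
  have [Kx|nKx] := pselect (K x); last first.
    by rewrite FK// normr0 mulr_ge0 ?C0//; lra.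
  have [h1 h2 h3] := HM _ Kx; apply: FC => //.
  + exact: radial_part_sqr_le_grad.
  + by rewrite h3 andbT divr_gt0// subr_gt0.
  + by rewrite -enorm_sqr -n2; exact: log_weight_bound.
  + by rewrite -enorm_sqr -n2; exact: log_weight_sqr_bound.
  + by rewrite -enorm_sqr -n2; exact: hardy_potential_bound.
Qed.

Lemma continuous_radial_div x : punctured_ball x -> {for x,
  continuous radial_div}.
Proof.
move=> Ox; have [xB x0] := Ox; have e01 := enorm_in01 xB x0.
have cl := cont_comp (@continuous_enorm x) (continuous_log_weight (n := n) e01).
have ch := cont_comp (@continuous_enorm x) (continuous_hardy_potential (n :=
  n) e01).
apply: cont_mul; first by apply: cont_pow; exact: continuous_conformal.
apply: cont_add.
  apply: cont_mul; last exact: continuous_radial_part.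
  apply: cont_mul; last exact: cl.
  by apply: cont_mul; [exact: cont_cst|exact: continuous_f].
apply: cont_mul; first by apply: cont_pow; exact: continuous_f.
by apply: cont_add; [apply: cont_pow; exact: cl|exact: ch].
Qed.

Let conformal_pow M k x : 1 <= M -> 0 < conformal x <= M ->
  0 <= conformal x ^+ k <= M ^+ k.
Proof.
move=> M1 /andP[/ltW c0 cM]; rewrite exprn_ge0//= lerXn2r// nnegrE.
exact: le_trans cM.
Qed.

Lemma integrable_grad_density : mu.-integrable Ot (EFin \o grad_density \o
  @row_of R N).
Proof.
apply: (integrable_supported (C := fun M => M ^+ N * M)).
- by move=> M M1; rewrite mulr_ge0 ?exprn_ge0//; lra.
- move=> x [xB x0]; apply: cont_mul; first by apply: cont_pow;
  exact: continuous_conformal.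
  apply: cont_mul; last exact: continuous_grad_sqr.
  apply: cont_mul; last exact: cont_cst.
  by apply: cont_pow; apply: cont_sub;
    [exact: cont_cst|exact: continuous_sqnorm].
- by move=> x [xB _] xK; rewrite /grad_density grad_sqr_off_support// !mulr0.
- move=> M b x [xB x0] M1 b1 _ _ gM cM _ _ _.
  have /andP[c0 c1] := conformal_pow N M1 cM.
  have g0 := grad_sqr_ge0 x.
  have q0 := sqnorm_ge0 x; have q1 : sqnorm x < 1 := xB.
  have h0 : 0 <= (1 - sqnorm x) ^+ 2 / 4 <= 1 by rewrite divr_ge0 ?sqr_ge0//=;
    nra.
  have /andP[h1 h2] := h0.
  rewrite ger0_norm; last by rewrite mulr_ge0// mulr_ge0.
  rewrite -[leLHS]mulr1 ler_pM//; first by rewrite mulr_ge0// mulr_ge0.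
  rewrite ler_pM//; first by rewrite mulr_ge0.
  by apply: le_trans gM; rewrite ler_piMl.
Qed.

Lemma integrable_radial_density : mu.-integrable Ot (EFin \o radial_density \o
  @row_of R N).
Proof.
apply: (integrable_supported (C := fun M => M ^+ N * M)).
- by move=> M M1; rewrite mulr_ge0 ?exprn_ge0//; lra.
- move=> x [xB x0]; apply: cont_mul; first by apply: cont_pow;
  exact: continuous_conformal.
  by apply: cont_pow; exact: continuous_radial_part.
- move=> x [xB _] xK; rewrite /radial_density /radial_part euler_off_support//.
  by rewrite mulr0 expr0n mulr0.
- move=> M b x [xB x0] M1 b1 _ rg gM cM _ _ _.
  have /andP[c0 c1] := conformal_pow N M1 cM.
  have g0 : 0 <= radial_part x ^+ 2 by exact: sqr_ge0.
  rewrite ger0_norm; last by rewrite mulr_ge0.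
  rewrite -[leLHS]mulr1 ler_pM//; first by rewrite mulr_ge0.
  by rewrite ler_pM// (le_trans rg).
Qed.

Lemma integrable_hardy_density : mu.-integrable Ot (EFin \o hardy_density \o
  @row_of R N).
Proof.
apply: (integrable_supported (C := fun M => M ^+ N * (n ^+ 2 * M))).
- by move=> M M1; rewrite !mulr_ge0 ?exprn_ge0//; lra.
- move=> x [xB x0]; apply: cont_mul; first by apply: cont_pow;
  exact: continuous_conformal.
  apply: cont_mul; last by apply: cont_pow; exact: continuous_f.
  apply: cont_comp; first exact: continuous_enorm.
  by apply: continuous_hardy_potential; exact: enorm_in01.
- by move=> x [xB _] xK; rewrite /hardy_density fK// expr0n !mulr0.
- move=> M b x [xB x0] M1 b1 fM _ _ cM _ _ hb.
  have /andP[c0 c1] := conformal_pow N M1 cM.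
  rewrite normrM ger0_norm// -mulrA ler_pM// normrM (ger0_norm (sqr_ge0 _)).
  rewrite [leRHS]mulrAC; apply: ler_pM => //; exact: sqr_ge0.
Qed.

Lemma integrable_radial_field : mu.-integrable Ot (EFin \o radial_field \o
  @row_of R N).
Proof.
apply: (integrable_supported (C := fun M => M * n * M ^+ N.-1)).
- by move=> M M1; rewrite !mulr_ge0 ?exprn_ge0//; lra.
- move=> x [xB x0]; apply: cont_mul; last by apply: cont_pow;
  exact: continuous_conformal.
  apply: cont_mul; first by apply: cont_pow; exact: continuous_f.
  apply: cont_mul.
    apply: cont_comp; first exact: continuous_enorm.
    by apply: continuous_log_weight; exact: enorm_in01.
  apply: cont_inv; last exact: continuous_enorm.
  by rewrite gt_eqF// enorm_gt0.
- by move=> x [xB _] xK; rewrite /radial_field fK// expr0n !mul0r.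
- move=> M b x [xB x0] M1 b1 fM _ _ cM lb _ _.
  have /andP[c0 c1] := conformal_pow N.-1 M1 cM.
  have lb' : `|log_weight n (enorm x) / enorm x| <= n * b.
    by rewrite normrM normfV (ger0_norm (enorm_ge0 _)).
  rewrite normrM (ger0_norm c0) [leRHS]mulrAC ler_pM//.
  rewrite normrM (ger0_norm (sqr_ge0 _)) -(mulrA M) ler_pM//; exact: sqr_ge0.
Qed.

Lemma integrable_radial_div : mu.-integrable Ot (EFin \o radial_div \o @row_of
  R N).
Proof.
(* With [F], [l], [r], [h] the values of [f], the log-derivative, the radial derivative and the
   potential, [|2 F l r| <= F^2 l^2 + r^2]. Together with [F^2 l^2] and [F^2 |h|] this makes three
   terms of size [M n^2 b], and [r^2 <= M <= M b]. *)
apply: (integrable_supported (C := fun M => M ^+ N * (M * (3 * n ^+ 2 + 1)))).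
- move=> M M1; rewrite mulr_ge0 ?exprn_ge0//; first by lra.
  by rewrite mulr_ge0 ?addr_ge0 ?mulr_ge0 ?sqr_ge0//; lra.
- exact: continuous_radial_div.
- by move=> x [xB _] xK; rewrite /radial_div fK// expr0n !(mulr0,
  mul0r) addr0 mulr0.
- move=> M b x [xB x0] M1 b1 fM rg gM cM _ lb hb.
  have /andP[c0 c1] := conformal_pow N M1 cM.
  rewrite normrM (ger0_norm c0) -[leRHS]mulrA ler_pM//.
  have -> : M * (3 * n ^+ 2 + 1) * b = M * (3 * (n ^+ 2 * b) + b) by ring.
  have rM : radial_part x ^+ 2 <= M by exact: le_trans gM.
  have f0 := sqr_ge0 (f x).
  move: hb lb; rewrite ler_norml; move: (n ^+ 2 * b) => B /andP[hb1 hb2] lb.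
  move: (f x) (log_weight _ _) (radial_part x) (hardy_potential _ _) fM f0 hb1
    hb2 lb rM
    => F l r h fM f0 hb1 hb2 lb rM.
  have l0 := sqr_ge0 l.
  have h1 : 0 <= F ^+ 2 * (B - l ^+ 2) by rewrite mulr_ge0// subr_ge0.
  have h2 : 0 <= F ^+ 2 * (B - h) by rewrite mulr_ge0// subr_ge0.
  have h2' : 0 <= F ^+ 2 * (B + h) by rewrite mulr_ge0//; lra.
  have h3 : 0 <= (M - F ^+ 2) * B by rewrite mulr_ge0 ?subr_ge0//; lra.
  have h4 : 0 <= M * (b - 1) by rewrite mulr_ge0 ?subr_ge0//; lra.
  have h5 := sqr_ge0 (F * l - r).
  have h6 := sqr_ge0 (F * l + r).
  rewrite ler_norml; apply/andP; split; nra.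
Qed.

End compact_support.

(** * The radial divergence theorem *)

Lemma cont_near_eq {R : realType} {T : topologicalType} (F G : T -> R) (t : T) :
  (\forall s \near t, F s = G s) -> {for t, continuous F} -> {for t,
    continuous G}.
Proof.
move=> FG cF; rewrite /prop_for /continuous_at -(nbhs_singleton FG).
by apply: cvg_trans cF; exact: near_eq_cvg.
Qed.

Section radial_divergence_theorem.
Context {R : realType} {N : nat}.
Variables (f : 'rV[R]_N -> R) (K : set 'rV[R]_N).
Hypotheses (N2 : (2 <= N)%N) (f_smooth : hsmooth f) (cK : compact K)
  (KB : K `<=` poincare_ball)
  (fK : forall x, poincare_ball x -> ~ K x -> f x = 0).
Implicit Types x y : 'rV[R]_N.
Local Notation n := (N%:R : R).
Local Notation mu := (@lebesgue_tuple R N).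
Local Notation Ot := [set t : N.-tuple R | punctured_ball (row_of t)].

(** Dilations leave the ball, so the field and its divergence are extended by zero. They vanish off
    [K], so the boundary of the ball creates no new singularity and the origin is the only
    exceptional point. *)
Let field0 : 'rV[R]_N -> R := radial_field f \_ punctured_ball.
Let div0 : 'rV[R]_N -> R := radial_div f \_ punctured_ball.

Let field0_off y : ~ K y -> field0 y = 0.
Proof.
move=> yK; rewrite /field0 patchE; case: ifPn => //; rewrite inE => -[yB _].
by rewrite /radial_field fK// expr0n !mul0r.
Qed.

Let div0_off y : ~ K y -> div0 y = 0.
Proof.
move=> yK; rewrite /div0 patchE; case: ifPn => //; rewrite inE => -[yB _].
by rewrite /radial_div fK// expr0n !(mulr0, mul0r) addr0 mulr0.
Qed.

Let near_off y : ~ K y -> \forall z \near y, ~ K z.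
Proof. by move=> yK; apply: open_nbhs_nbhs; split => //;
  exact: open_setC_compact. Qed.

Let near_in y : punctured_ball y -> \forall z \near y, punctured_ball z.
Proof. by move=> yO; apply: open_nbhs_nbhs; split => //;
  exact: open_punctured_ball. Qed.

Let continuous_div0 y : y != 0 -> {for y, continuous div0}.
Proof.
move=> y0; have [yO|yO] := pselect (punctured_ball y).
  apply: (cont_near_eq _ (continuous_radial_div f_smooth yO)).
  have := near_in yO; apply: filterS => z zO /=.
  by rewrite /div0 patchE mem_set.
have yK : ~ K y by move=> /KB yB; exact: yO.
apply: (cont_near_eq (F := fun=> 0)); last exact: cont_cst.
have := near_off yK; apply: filterS => z zK /=.
by rewrite div0_off.
Qed.

Lemma is_derive_pow (F : R -> R) (t dF : R) k : is_derive t 1 F dF ->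
  is_derive t 1 (fun s => F s ^+ k.+1) (k.+1%:R * F t ^+ k * dF).
Proof.
move=> Ft; elim: k => [|k IH].
  by rewrite expr0 mulr1 mul1r; under eq_fun do rewrite expr1.
under eq_fun do rewrite exprS.
apply: is_derive_eq (is_derive_mul Ft IH) _.
by rewrite -[k.+2%:R]natr1 !exprS; move: (k.+1%:R : R) => a; ring.
Qed.

(** Along the ray, [r^N a(r x) = f^2 h m^(N-1) / |x|], where [m |x|] is [sinh] of the distance to
    the origin. The logarithmic derivative of [m^(N-1)] is [(N-1) coth rho] times the speed of
    [rho], which cancels the coth term of the Riccati equation and leaves [h^2 + W]. *)
Let is_derive_field_in x (s : R) : 0 < s -> punctured_ball (s *: x) ->
  is_derive s 1 (fun r => r ^+ N * radial_field f (r *: x))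
    (s ^+ N.-1 * radial_div f (s *: x)).
Proof.
move=> s0 [sB sx0].
have x0 : x != 0 by apply: contraNneq sx0 => ->; rewrite scaler0.
have r00 := enorm_gt0 x0.
set r0 := enorm x in r00; pose T := \sum_i x 0 i * partial i f (s *: x).
have eE (r : R) : 0 < r -> enorm (r *: x) = r * r0.
  by move=> rp; rewrite /enorm sqnormZ sqrtrM ?sqr_ge0// sqrtr_sqr gtr0_norm.
have qE (r : R) : sqnorm (r *: x) = r ^+ 2 * r0 ^+ 2.
  by rewrite sqnormZ /r0 enorm_sqr.
have sr := enorm_in01 sB sx0; rewrite eE// in sr.
have q0 : 1 - s ^+ 2 * r0 ^+ 2 != 0 by rewrite -qE gt_eqF// subr_gt0; exact: sB.
pose m (r : R) := r * (2 / (1 - r ^+ 2 * r0 ^+ 2)).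
pose l (r : R) := log_weight n (r * r0).
pose W := hardy_potential n (s * r0).
pose C := coth_radius (s * r0).
pose lam := 2 / (1 - s ^+ 2 * r0 ^+ 2).
have df : is_derive s 1 (fun r : R => f (r *: x)) T.
  exact: is_derive_comp_curve (hsmooth_differentiable f_smooth sB)
    (is_derive_segment x s).
have dm : is_derive s 1 m (m s * (C * lam * r0)).
  have dq : is_derive s 1 (fun r : R =>
    1 - r ^+ 2 * r0 ^+ 2) (0 - 2 * s * r0 ^+ 2).
    apply: is_derive_eq (is_derive_sub (is_derive_const 1 s 1)
      (is_derive_mul (is_derive_sqr (is_derive_id s 1)) (is_derive_const (r0
        ^+ 2) s 1))) _.
    by ring.
  have dg := is_derive_div (x := s)
    (g := fun r : R => 1 - r ^+ 2 * r0 ^+ 2) q0 (is_derive_const 2 s 1) dq.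
  apply: is_derive_eq (is_derive_mul (is_derive_id s 1) dg) _.
  rewrite /m /C /lam /coth_radius /=; field.
  by rewrite exprMn q0 !gt_eqF.
have dl : is_derive s 1 l (lam * (W + l s ^+ 2 - (n - 1) * C * l s) * r0).
  have dsr : is_derive s 1 (fun r : R => r * r0) r0.
    by apply: is_derive_eq (is_derive_mul (is_derive_id s 1) (is_derive_const
      r0 s 1)) _;
      rewrite mulr0 addr0 mul1r.
  apply: is_derive_eq (is_derive_chain dsr (is_derive_log_weight n sr)) _.
  by rewrite exprMn.
(* Since [N >= 2], the powers of exponent [N] and [N.-1] reduce to powers of exponent [j], which are
   then opaque to [field]. *)
have [j Nj] : exists j, N = j.+2 by case: N N2 => [|[|j]] //; exists j.
have powN (c : R) : c ^+ N = c * (c * c ^+ j) by rewrite Nj !exprS.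
have powN1 (c : R) : c ^+ N.-1 = c * c ^+ j by rewrite Nj exprS.
have E : is_derive s 1 (fun r => f (r *: x) ^+ 2 * l r * m r ^+ j.+1 / r0)
   (s ^+ N.-1 * radial_div f (s *: x)).
  apply: is_derive_eq (is_derive_mul (is_derive_mul (is_derive_mul
    (is_derive_sqr df) dl)
    (is_derive_pow j dm)) (is_derive_const r0^-1 s 1)) _.
  rewrite /radial_div /radial_part /conformal eE// qE -/W -/(l s).
  have -> : euler f (s *: x) = s * T.
    by rewrite /euler /T mulr_sumr; apply: eq_bigr => i _; rewrite mxE mulrA.
  have n1 : n - 1 = j.+1%:R by rewrite Nj -natr1 addrK.
  rewrite n1 powN powN1 -/lam.
  have lam2 : (1 - s ^+ 2 * r0 ^+ 2) = 2 / lam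
    by rewrite /lam invf_div [RHS]mulrC divfK.
  have lam0 : lam != 0 by rewrite mulf_neq0 ?invr_eq0.
  rewrite lam2 /m -/lam [_ ^+ j.+1]exprS [(s * lam) ^+ j]exprMn.
  move: (f (s *: x)) (l s) (T) (s ^+ j) (lam ^+ j) => F L T' sj lj.
  move: lam0; move: (j.+1%:R : R) (W) (C) (lam) => k w c la la0.
  by field; rewrite la0 !gt_eqF.
apply: near_eq_is_derive E.
have : \forall r \near s, 0 < r by exact: lt_nbhsr.
apply: filterS => r rp; rewrite /radial_field eE// /conformal qE -/(l r) powN
  powN1 /m.
rewrite [(r * _) ^+ _]exprS [(r * _) ^+ _]exprMn; move: (2 / _) => c.
move: (r ^+ j) (c ^+ j) (l r) (f _) => *.
by field; rewrite !gt_eqF.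
Qed.

Let is_derive_field x (s : R) : x != 0 -> 0 < s ->
  is_derive s 1 (fun r => r ^+ N * field0 (r *: x)) (s ^+ N.-1 * div0 (s *: x)).
Proof.
move=> x0 s0; have sx0 : s *: x != 0 by rewrite scaler_eq0 negb_or gt_eqF.
have cs : {for s, continuous (fun r : R => r *: x)}.
  apply: differentiable_continuous; apply/derivable1_diffP.
  by have [] := is_derive_segment x s.
have [sO|sO] := pselect (punctured_ball (s *: x)).
  rewrite /div0 patchE mem_set//.
  apply: near_eq_is_derive (is_derive_field_in s0 sO).
  have : \forall r \near s, punctured_ball (r *: x) by exact: cs _ (near_in sO).
  apply: filterS => r rO /=.
  by rewrite /field0 patchE mem_set.
have sK : ~ K (s *: x) by move=> /KB sB; exact: sO.
rewrite div0_off// mulr0; apply: near_eq_is_derive (is_derive_const 0 s 1).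
have : \forall r \near s, ~ K (r *: x) by exact: cs _ (near_off sK).
apply: filterS => r rK /=.
by rewrite field0_off// mulr0.
Qed.

Let FTC x : x != 0 ->
  (\int[lebesgue_measure]_(s in `[1%R, 2%R]) (s ^+ N.-1 * div0 (s *: x))%:E =
   (2 ^+ N * field0 (2 *: x))%:E - (field0 x)%:E)%E.
Proof.
move=> x0; have p (s : R) : 1 <= s -> 0 < s by exact: lt_le_trans.
have cF (s : R) : 0 < s -> {for s, continuous (fun r : R =>
  r ^+ N * field0 (r *: x))}.
  move=> s0; apply: differentiable_continuous; apply/derivable1_diffP.
  by have [] := is_derive_field x0 s0.
rewrite (@continuous_FTC2 _ _ (fun r => r ^+ N * field0 (r *: x))).
- by rewrite expr1n mul1r scale1r.
- by rewrite ltr1n.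
- apply: continuous_in_subspaceT => s; rewrite inE /= in_itv /= =>
  /andP[/p s0 _].
  suff : {for s, continuous (fun r : R => r ^+ N.-1 * div0 (r *: x))} by [].
  apply: cont_mul; first exact: exprn_continuous.
  have sx0 : s *: x != 0 by rewrite scaler_eq0 negb_or gt_eqF.
  have cs : {for s, continuous (fun r : R => r *: x)}.
    apply: differentiable_continuous; apply/derivable1_diffP.
    by have [] := is_derive_segment x s.
  exact: (cvg_comp _ _ cs (continuous_div0 sx0)).
- split.
  + by move=> s; rewrite in_itv /= => /andP[/ltW/p s0 _];
    have [] := is_derive_field x0 s0.
  + exact: cvg_at_right_filter (cF 1 ltr01).
  + exact: cvg_at_left_filter (cF 2 (ltr0n _ 2)).
- move=> s; rewrite in_itv /= => /andP[/ltW/p s0 _].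
  by rewrite derive1E; have [_ ->] := is_derive_field x0 s0.
Qed.

Let restrictE (g : 'rV[R]_N -> R) :
  (EFin \o g \o @row_of R N) \_ Ot = EFin \o (g \_ punctured_ball) \o @row_of
    R N.
Proof.
apply/funext => t; rewrite /= !patchE.
have -> : (t \in Ot) = (row_of t \in punctured_ball) by apply/idP/idP;
  rewrite !inE.
by case: ifP.
Qed.

Lemma integral_radial_div_eq0 :
  (\int[mu]_(t in Ot) (radial_div f (row_of t))%:E = 0)%E.
Proof.
have mO := @measurable_punctured_ball R N.
rewrite integral_mkcond -[X in integral _ _ X]/((EFin \o radial_div f \o
  @row_of R N) \_ Ot).
rewrite restrictE.
apply: (@integral_radial_div _ N (field0 \o @row_of R N) (div0 \o @row_of R N)).
- exact: leq_trans N2.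
- rewrite -[EFin \o _]/(EFin \o field0 \o @row_of R N) -restrictE.
  by apply: (integrable_mkcond _ _).1 => //;
    exact: integrable_radial_field cK KB fK.
- rewrite -[EFin \o _]/(EFin \o div0 \o @row_of R N) -restrictE.
  by apply: (integrable_mkcond _ _).1 => //;
    exact: integrable_radial_div cK KB fK.
(* At the origin both sides are zero because the extended functions vanish there; any other ray
   segment avoids the origin. *)
- move=> t; have [t0|t0] := eqVneq (row_of t) 0.
    have z0 (g : 'rV[R]_N -> R) : (g \_ punctured_ball) 0 = 0.
      by rewrite patchE; case: ifPn => //; rewrite inE => -[_]; rewrite eqxx.
    under eq_integral do rewrite /= row_of_scale t0 scaler0 [div0 0]z0 mulr0.
    by rewrite integral0 /= row_of_scale t0 scaler0 [field0 0]z0 mulr0 subee.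
  under eq_integral do rewrite /= row_of_scale.
  by rewrite FTC//= row_of_scale.
Qed.

End radial_divergence_theorem.

(** * The Hardy identities *)

Section hardy.
Context {R : realType} {N : nat}.
Variables (f : 'rV[R]_N -> R) (K : set 'rV[R]_N).
Hypotheses (N2 : (2 <= N)%N) (f_smooth : hsmooth f) (cK : compact K)
  (KB : K `<=` poincare_ball)
  (fK : forall x, poincare_ball x -> ~ K x -> f x = 0).
Implicit Types x : 'rV[R]_N.
Local Notation n := (N%:R : R).
Local Notation mu := (@lebesgue_tuple R N).
Local Notation Ot := [set t : N.-tuple R | punctured_ball (row_of t)].
Local Notation integrable_Ot G := (mu.-integrable Ot (EFin \o G \o @row_of R
  N)).
Local Notation "\int_Ot G" := (\int[mu]_(t in Ot) (G (row_of t))%:E)%E (at level 10).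

Let N0 : (0 < N)%N. Proof. exact: leq_trans N2. Qed.

Let mO := @measurable_punctured_ball R N.

Definition hardy_weight x : R := (n - 1) ^+ 2 / 4 + 1 / 4 * (1 / rho x ^+ 2) +
  (n - 1) * (n - 3) / 4 * (1 / sinh (rho x) ^+ 2).

Lemma hardy_weightE x : punctured_ball x ->
  hardy_weight x = hardy_potential n (enorm x).
Proof.
move=> [xB x0]; have /andP[r0 r1] := enorm_in01 xB x0.
by rewrite /hardy_weight rhoE// sinh_artanh2// r1 andbT; lra.
Qed.

Definition grad_remainder x : R := grad_density f x + radial_div f x -
  hardy_density f x.
Definition radial_remainder x : R := radial_density f x + radial_div f x -
  hardy_density f x.

Lemma grad_remainderE x : punctured_ball x ->
  rho x / sinh (rho x) ^+ N.-1 * hnorm x (hgrad (ground_quotient f) x) ^+ 2 *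
    (2 / (1 - sqnorm x)) ^+ N = grad_remainder x.
Proof.
move=> [xB x0]; rewrite hgrad_ground_quotient//;
  last exact: hsmooth_differentiable.
rewrite hnorm_hgrad_sqr// /grad_remainder /grad_density /radial_div
  /hardy_density.
rewrite -/(conformal x) -/(grad_sqr f x) -/(euler f x) -/(radial_part f x).
move: (conformal x ^+ N) (_ / 4 * _) (log_weight _ _) (hardy_potential _ _) =>
  c g l h.
by move: (radial_part f x) (f x) => r F; ring.
Qed.

Lemma radial_remainderE x : punctured_ball x ->
  rho x / sinh (rho x) ^+ N.-1 * `|radial_derive (ground_quotient f) x| ^+ 2 *
    (2 / (1 - sqnorm x)) ^+ N = radial_remainder x.
Proof.
move=> [xB x0]; have fx := hsmooth_differentiable f_smooth xB.
rewrite real_normK ?num_real// radial_ground_quotient// radial_deriveE//.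
rewrite /radial_remainder /radial_density /radial_div /hardy_density.
rewrite -/(conformal x) -/(euler f x) -/(radial_part f x).
move: (conformal x ^+ N) (log_weight _ _) (hardy_potential _ _) => c l h.
by move: (radial_part f x) (f x) => r F; ring.
Qed.

(** Used with [G] the gradient density and with [G] the radial density: integrability allows the
    integral to be split, and the divergence term drops out. *)
Lemma integral_remainder (G : 'rV[R]_N -> R) : integrable_Ot G ->
  integrable_Ot (fun x => G x + radial_div f x - hardy_density f x) /\
  (\int_Ot (fun x => (G x + radial_div f x - hardy_density f x)%R) =
   \int_Ot G - \int_Ot (hardy_density f))%E.
Proof.
move=> iG; have iD := integrable_radial_div N2 f_smooth cK KB fK.
have iH := integrable_hardy_density N2 f_smooth cK KB fK.
have iGD : mu.-integrable Ot (fun t =>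
  (G (row_of t))%:E + (radial_div f (row_of t))%:E)%E.
  exact: integrableD.
split; first exact: (integrableB _ iGD iH).
have -> : (\int_Ot (fun x => (G x + radial_div f x - hardy_density f x)%R) =
    \int[mu]_(t in Ot) ((G (row_of t))%:E + (radial_div f (row_of t))%:E
                        - (hardy_density f (row_of t))%:E))%E by [].
rewrite integralB// integralD//.
by rewrite (integral_radial_div_eq0 N2 f_smooth cK KB fK) adde0.
Qed.

Lemma hintegral_grad :
  (hintegral (fun x => (hnorm x (hgrad f x) ^+ 2)%R) = \int_Ot (grad_density
    f))%E.
Proof.
apply: (hintegralE N0 _ _).2; last exact: integrable_grad_density cK KB fK.
move=> x [xB x0]; rewrite hnorm_hgrad_sqr// mulrC //.
Qed.

Lemma hintegral_radial :
  (hintegral (fun x => (`|radial_derive f x| ^+ 2)%R) = \int_Ot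
    (radial_density f))%E.
Proof.
apply: (hintegralE N0 _ _).2; last exact: integrable_radial_density cK KB fK.
move=> x [xB x0]; rewrite real_normK ?num_real// mulrC radial_deriveE//.
exact: hsmooth_differentiable.
Qed.

Lemma hintegral_hardy :
  (hintegral (fun x => (hardy_weight x * `|f x| ^+ 2)%R) = \int_Ot
    (hardy_density f))%E.
Proof.
apply: (hintegralE N0 _ _).2; last exact: integrable_hardy_density cK KB fK.
by move=> x Ox; rewrite real_normK ?num_real// hardy_weightE// mulrC.
Qed.

Lemma hintegral_grad_remainder :
  (hintegral (fun x => (rho x / sinh (rho x) ^+ N.-1 *
     hnorm x (hgrad (ground_quotient f) x) ^+ 2)%R) =
   \int_Ot (grad_density f) - \int_Ot (hardy_density f))%E.
Proof.
have [i <-] := integral_remainder (integrable_grad_density N2 f_smooth cK KB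
  fK).
exact: (hintegralE N0 grad_remainderE i).2.
Qed.

Lemma hintegral_radial_remainder :
  (hintegral (fun x => (rho x / sinh (rho x) ^+ N.-1 *
     `|radial_derive (ground_quotient f) x| ^+ 2)%R) =
   \int_Ot (radial_density f) - \int_Ot (hardy_density f))%E.
Proof.
have [i <-] := integral_remainder (integrable_radial_density N2 f_smooth cK KB
  fK).
exact: (hintegralE N0 radial_remainderE i).2.
Qed.

Lemma integral_radial_le_grad :
  (\int_Ot (radial_density f) <= \int_Ot (grad_density f))%E.
Proof.
apply: le_integral => //.
- exact: integrable_radial_density cK KB fK.
- exact: integrable_grad_density cK KB fK.
move=> t; rewrite inE => Ox; rewrite lee_fin ler_wpM2l//.
  case: Ox => xB _; rewrite exprn_ge0// divr_ge0// subr_ge0 ltW//; exact: xB.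
exact: radial_part_sqr_le.
Qed.

Lemma integral_hardy_le_radial :
  (\int_Ot (hardy_density f) <= \int_Ot (radial_density f))%E.
Proof.
have iR := integrable_radial_density N2 f_smooth cK KB fK.
have iH := integrable_hardy_density N2 f_smooth cK KB fK.
rewrite -suber_ge0; last exact: (integrable_fin_num mO iH).
have [_ <-] := integral_remainder iR.
apply: integral_ge0 => t Ox; rewrite lee_fin.
(* Rewritten through [radial_remainderE], the integrand is a product of nonnegative factors. *)
have := radial_remainderE Ox; rewrite /radial_remainder => <-.
case: Ox => xB x0; have r0 := rho_gt0 xB x0; have s0 := sinh_gt0 r0.
rewrite !mulr_ge0 ?sqr_ge0// ?invr_ge0 ?exprn_ge0 ?ltW//.
by rewrite divr_gt0// subr_gt0; exact: xB.
Qed.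

End hardy.

Theorem theorem1p4 (R : realType) (N : nat) (hN : (2 <= N)%N)
    (f : 'rV[R]_N -> R) (f_smooth : hsmooth f) (f_supp : hcompact_support f) :
  let n : R := N%:R in
  let W x := (n - 1) ^+ 2 / 4 + 1 / 4 * (1 / rho x ^+ 2) +
             (n - 1) * (n - 3) / 4 * (1 / sinh (rho x) ^+ 2) in
  let g x := sinh (rho x) `^ ((n - 1) / 2) * f x / rho x `^ (1 / 2) in
  [/\ (hintegral (fun x => (hnorm x (hgrad f x) ^+ 2)%R)
       - hintegral (fun x => (W x * `|f x| ^+ 2)%R) =
       hintegral (fun x => (rho x / sinh (rho x) ^+ N.-1
                           * hnorm x (hgrad g x) ^+ 2)%R))%E,
      (hintegral (fun x => (`|radial_derive f x| ^+ 2)%R)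
       - hintegral (fun x => (W x * `|f x| ^+ 2)%R) =
       hintegral (fun x => (rho x / sinh (rho x) ^+ N.-1
                           * `|radial_derive g x| ^+ 2)%R))%E,
      (hintegral (fun x => (hnorm x (hgrad f x) ^+ 2)%R) >=
       hintegral (fun x => (`|radial_derive f x| ^+ 2)%R))%E
    & (hintegral (fun x => (`|radial_derive f x| ^+ 2)%R) >=
       hintegral (fun x => (W x * `|f x| ^+ 2)%R))%E].
Proof.
have [K [cK KB fK]] := f_supp.
move=> n W g.
rewrite -[g]/(ground_quotient f) -[W]/(@hardy_weight R N).
rewrite (hintegral_grad hN f_smooth cK KB fK) (hintegral_radial hN f_smooth cK KB fK).
rewrite (hintegral_hardy hN f_smooth cK KB fK).
rewrite (hintegral_grad_remainder hN f_smooth cK KB fK).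
rewrite (hintegral_radial_remainder hN f_smooth cK KB fK).
split => //.
- exact: integral_radial_le_grad cK KB fK.
- exact: integral_hardy_le_radial cK KB fK.
Qed.
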